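(* Let $G$ be a finite simple $2$-connected graph. If $G$ is $\{K_{1,3},W\}$-heavy, then $G$ is Hamiltonian.
   Context: Let $G$ be a graph on $n$ vertices. An induced subgraph $H'$ of $G$ is called heavy if there exist two nonadjacent vertices in $H'$ whose degree sum in $G$ is at least $n$. For a graph $H$, $G$ is $H$-heavy if every induced subgraph of $G$ isomorphic to $H$ is heavy; for a family $\mathcal{H}$ of graphs, $G$ is $\mathcal{H}$-heavy if it is $H$-heavy for every $H\in\mathcal{H}$. $K_{1,3}$ is the claw (a star with three leaves). $W$ (the ''wounded'') is the graph on 6 vertices obtained from a triangle $abc$ by attaching a pendant edge $aa'$ at $a$ and a pendant path $bb'b''$ of length $2$ at $b$ (the vertex $c$ has degree $2$). *)

(* Defs.v *)
From HB Require Import structures.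
From mathcomp Require Import all_boot.

Set Implicit Arguments.
Unset Strict Implicit.
Unset Printing Implicit Defensive.

Record sgraph := SGraph {
  vertex :> finType;
  edge : rel vertex;
  edge_sym : symmetric edge;
  edge_irrefl : irreflexive edge }.

Arguments edge {s} _ _.

Definition degree (G : sgraph) (x : G) : nat := #|[set y | edge x y]|.

Section Induced.
Variables (G : sgraph) (S : {set G}).

Definition induced_edge : rel {x : G | x \in S} :=
  fun x y => edge (val x) (val y).

Lemma induced_edge_sym : symmetric induced_edge.
Proof. by move=> x y; apply: edge_sym. Qed.

Lemma induced_edge_irrefl : irreflexive induced_edge.
Proof. by move=> x; apply: edge_irrefl. Qed.

Definition induced : sgraph := SGraph induced_edge_sym induced_edge_irrefl.

End Induced.

Definition isomorphic (G H : sgraph) : Prop :=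
  exists2 f : G -> H, bijective f & forall x y, edge (f x) (f y) = edge x y.

Definition connected (G : sgraph) : Prop := forall x y : G, connect edge x y.

(* The order bound k < #|G| makes K_n (n-1)-connected but not n-connected;
   it also keeps the graphs below nonempty. *)
Definition k_connected (k : nat) (G : sgraph) : Prop :=
  k < #|G| /\ forall S : {set G}, #|S| < k -> connected (induced (~: S)).

Definition hamiltonian (G : sgraph) : Prop :=
  exists c : seq G, [/\ 2 < size c, ucycle edge c & forall x, x \in c].

(* Adjacency within the subgraph induced by S agrees with adjacency in G;
   degrees are taken in G. *)
Definition heavy (G : sgraph) (S : {set G}) : Prop :=
  exists x y : G, [/\ x \in S, y \in S, x != y, ~~ edge x y
                    & #|G| <= degree x + degree y].

Definition H_heavy (H G : sgraph) : Prop :=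
  forall S : {set G}, isomorphic (induced S) H -> heavy S.

Definition family_heavy (F : sgraph -> Prop) (G : sgraph) : Prop :=
  forall H : sgraph, F H -> H_heavy H G.

Section EdgeList.
Variables (n : nat) (s : seq (nat * nat)).

Definition elist_edge : rel 'I_n := fun i j =>
  (i != j) && (((i : nat, j : nat) \in s) || ((j : nat, i : nat) \in s)).

Lemma elist_edge_sym : symmetric elist_edge.
Proof. by move=> i j; rewrite /elist_edge eq_sym orbC. Qed.

Lemma elist_edge_irrefl : irreflexive elist_edge.
Proof. by move=> i; rewrite /elist_edge eqxx. Qed.

Definition elist_graph : sgraph := SGraph elist_edge_sym elist_edge_irrefl.

End EdgeList.

Definition claw : sgraph := elist_graph 4 [:: (0, 1); (0, 2); (0, 3)].

(* a = 0, b = 1, c = 2, a' = 3, b' = 4, b'' = 5 *)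
Definition wounded : sgraph :=
  elist_graph 6 [:: (0, 1); (0, 2); (1, 2); (0, 3); (1, 4); (4, 5)].

(* Main.v *)
(* Pairs that are adjacent or have degree sum at least n ([ore]) behave like
   edges on cycles: by the Bondy-Chvatal argument an [ore]-cycle can be turned
   into a cycle that is at least as long, so no [ore]-cycle is longer than a
   longest cycle C.  Suppose C misses a component H of G - C, and let u, v be
   consecutive attachments of H on C.  Grow an arc around u and an arc around
   v, one vertex at a time, such that each arc has spanning [ore]-paths from
   its root to both of its ends.  Rerouting C through H then shows that the
   arcs never meet, that their vertices and next vertices are not [ore]-related
   to H, and that those of one arc are not [ore]-related to the ones on the
   opposite side of the other arc.  Hence a degree sum of at least n between the
   two sides of the arc at u and another one at v cannot coexist, and one of
   the arcs, say that at u, is free of such pairs.  There, claws and wounded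
   subgraphs force the distance levels from u to be cliques that are completely
   joined to the next level, so the arc can be extended.  As C is finite, this
   is a contradiction.
     The only remaining obstacle is a heavy pair formed by u and the second
   vertex of a path leaving u through H; it is excluded by counting neighbours
   along C, since C has maximum length. *)

Require Import Defs.
From mathcomp Require Import all_boot.
From mathcomp Require Import zify.

Set Implicit Arguments.
Unset Strict Implicit.
Unset Printing Implicit Defensive.

(** The obstacle is that a claw or wounded subgraph only yields a heavy pair, whereas the next such
    subgraph has to be built from genuine edges. An [ore]-pair may be used on a cycle, but as a side
    of an induced subgraph it must first be known to be an edge. This is why the arcs are examined
    through degree sums: at a root whose two sides have no heavy pair between them, one side has no
    heavy pair inside it either, and on that side [ore] and [edge] agree. It becomes the skeleton on
    which the wounded subgraphs are erected. The long arm of a wounded subgraph has two edges, so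
    close to the root it must leave the arc, as [u], [z], [z'] with [z] in the component, and [u],
    [z'] must not be an [ore]-pair. Consecutiveness of the attachments enters here: since no vertex
    between them sees the component, degrees can be counted against the length of a rerouted cycle.
    If [u] and [v] are adjacent and all of the component is joined to [u], such an arm may be
    missing; then the arc is kept inside the neighbourhood of [u] and is extended by claws. *)

Section Lists.
Variable T : Type.

Lemma first_consecutive (R : rel T) (s : seq T) :
  sorted [rel a b | ~~ R a b] s \/
  exists s1 a b s2, [/\ s = s1 ++ a :: b :: s2, R a b
    & sorted [rel a b | ~~ R a b] (rcons s1 a)].
Proof.
elim: s => [|a s IH]; first by left.
case: s IH => [|b s] IH; first by left.
case Rab: (R a b); first by right; exists [::], a, b, s.
case: IH => [IH|[s1 [a' [b' [s2 [E Rab' srt]]]]]].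
  by left; rewrite /= Rab.
right; exists (a :: s1), a', b', s2; split => //; first by rewrite E.
by case: s1 E srt => [|c s1] [<- _] /=; rewrite Rab.
Qed.

(** Every element satisfying [p] is charged to its successor, which fails [q]; only the last element
    has no successor. With [p], [q] neighbourhoods of two vertices, this bounds a degree sum along a
    cycle without crossing chords. *)
Lemma count_followed (p q : pred T) x (s : seq T) :
  path [rel a b | p a ==> ~~ q b] x s ->
  count p (x :: s) <= count (predC q) s + p (last x s).
Proof.
elim: s x => [|y s IH] x /=; first by rewrite addn0.
case/andP=> /implyP pq /IH /=.
case px: (p x) pq => pq; last by lia.
by rewrite pq //=; lia.
Qed.

Lemma count_preceded (p q : pred T) x (s : seq T) :
  path [rel a b | q a ==> ~~ p b] x s ->
  count p s + ~~ q (last x s) <= count (predC q) (x :: s).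
Proof.
elim: s x => [|y s IH] x /=; first by rewrite add0n addn0.
case/andP=> /implyP pq /IH /=.
case py: (p y) pq => /= pq; last by lia.
case qx: (q x) pq => /= pq; last by lia.
by move: (pq isT).
Qed.

End Lists.

Section EqLists.
Variable T : eqType.

Lemma path_suffix_last (e : rel T) (K : pred T) x s :
  path e x s -> K x ->
  exists k t, [/\ K k, path e k t, last k t = last x s,
    subseq (k :: t) (x :: s) & ~~ has K t].
Proof.
elim/last_ind: s => [|s y IH]; first by move=> _ Kx; exists x, [::]; split.
rewrite rcons_path => /andP[ps ey] Kx.
case: (boolP (K y)) => Ky.
  exists y, [::]; split => //; first by rewrite last_rcons.
  by rewrite sub1seq inE mem_rcons inE eqxx orbT.
have [k [t [Kk pt lt st ht]]] := IH ps Kx.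
exists k, (rcons t y); split => //.
- by rewrite rcons_path pt lt.
- by rewrite !last_rcons.
- by rewrite -!rcons_cons -!cats1; apply: cat_subseq.
- by rewrite has_rcons negb_or Ky.
Qed.

Lemma ucycle_rot_to (e : rel T) c x : ucycle e c -> x \in c ->
  exists s, ucycle e (x :: s) /\ perm_eq (x :: s) c.
Proof.
move=> /andP[cc uc] /rot_to[i s E]; exists s; rewrite -E; split.
  by rewrite /ucycle rot_cycle cc rot_uniq.
by rewrite perm_rot.
Qed.

Lemma perm_uniq_imp (s t : seq T) : perm_eq s t -> uniq t -> uniq s.
Proof. by move=> /perm_uniq ->. Qed.

End EqLists.

Ltac perm_by_count :=
  apply/permP => ?;
  repeat first [rewrite count_cat | rewrite count_rev | rewrite -cats1
               | progress rewrite /=]; clear; lia.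

(** * Cycles up to heavy pairs *)

Definition graph_order (G : sgraph) : nat := #|G|.

Section OrePaths.
Variable G : sgraph.
Implicit Types (x y z : G) (s l : seq G).

(* The set of pairs usually denoted by E with a tilde. *)
Definition ore : rel G :=
  fun x y => (x != y) && (edge x y || (graph_order G <= degree x + degree y)).

Lemma ore_sym : symmetric ore.
Proof. by move=> x y; rewrite /ore eq_sym edge_sym addnC. Qed.

Lemma edge_neq x y : edge x y -> x != y.
Proof. by apply: contraTneq => ->; rewrite edge_irrefl. Qed.

Lemma edge_ore x y : edge x y -> ore x y.
Proof. by move=> e; rewrite /ore e edge_neq. Qed.

Lemma edge_path_ore x s : path edge x s -> path ore x s.
Proof. by apply: sub_path => ? ?; apply: edge_ore. Qed.

Lemma oreNedge x y : ~~ ore x y -> ~~ edge x y.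
Proof. by apply: contra; apply: edge_ore. Qed.

Lemma ore_degree x y : ore x y -> ~~ edge x y -> graph_order G <= degree x + degree y.
Proof. by case/andP=> _ /orP[-> //|]. Qed.

Lemma ore_light x y : ore x y -> degree x + degree y < graph_order G -> edge x y.
Proof. by case/andP=> _ /orP[//|] h; rewrite ltnNge h. Qed.

Lemma nore_light x y : x != y -> ~~ ore x y -> degree x + degree y < graph_order G.
Proof. by rewrite /ore => -> /=; rewrite negb_or -ltnNge => /andP[]. Qed.

Lemma light_nore x y : ~~ edge x y -> degree x + degree y < graph_order G -> ~~ ore x y.
Proof. by move=> e h; apply: contra e => /ore_light; apply. Qed.

Lemma path_revP (e : rel G) x s : symmetric e ->
  path e x s -> path e (last x s) (rev (belast x s)).
Proof. by move=> es; rewrite rev_path; apply: sub_path => a b; rewrite es. Qed.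

Lemma last_rev_belast x s : last (last x s) (rev (belast x s)) = x.
Proof. by case: s => //= y s; rewrite rev_cons last_rcons. Qed.

Lemma rev_last x s : rev (x :: s) = last x s :: rev (belast x s).
Proof. by rewrite lastI rev_rcons. Qed.

Lemma rcons_path_rev (e : rel G) x y s : symmetric e ->
  path e x (rcons s y) -> path e y (rcons (rev s) x).
Proof.
move=> es /(path_revP es); rewrite last_rcons belast_rcons.
by rewrite rev_cons.
Qed.

(* [l] is an enumeration, in any order, of the vertices of the path. *)
Definition opath x y l :=
  exists s, [/\ path ore x s, last x s = y & perm_eq (x :: s) l].

Lemma opath_perm x y l l' : opath x y l -> perm_eq l l' -> opath x y l'.
Proof.
by case=> s [p e q] q'; exists s; split => //; apply: perm_trans q q'.
Qed.

Lemma opath_sym x y l : opath x y l -> opath y x l.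
Proof.
case=> s [p <- q]; exists (rev (belast x s)); split.
- exact: path_revP ore_sym p.
- exact: last_rev_belast.
- by apply: perm_trans q; rewrite -rev_rcons -lastI perm_rev.
Qed.

Lemma opath1 x : opath x x [:: x].
Proof. by exists [::]. Qed.

Lemma opath_path x s : path ore x s -> opath x (last x s) (x :: s).
Proof. by exists s. Qed.

Lemma opath_extend x y l s :
  opath x y l -> path ore y s -> opath x (last y s) (l ++ s).
Proof.
case=> t [p <- q] ps; exists (t ++ s); split.
- by rewrite cat_path p.
- by rewrite last_cat.
- by rewrite -cat_cons perm_cat2r.
Qed.

Lemma opath_cat x y l x' y' l' :
  opath x y l -> ore y x' -> opath x' y' l' -> opath x y' (l ++ l').
Proof.
move=> h e [t [p <- q]].
have := @opath_extend _ _ _ (x' :: t) h; rewrite /= e p => /(_ isT) h'.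
by apply: opath_perm h' _; rewrite perm_cat2l.
Qed.

Lemma card_count l (P : pred G) : uniq l -> #|[set y in l | P y]| = count P l.
Proof.
move=> ul; rewrite -size_filter -(card_uniqP (filter_uniq P ul)).
by apply: eq_card => y; rewrite !inE mem_filter andbC.
Qed.

Lemma degree_split l x : uniq l ->
  degree x = count (edge x) l + #|[set y | (y \notin l) && edge x y]|.
Proof.
move=> ul; rewrite -(card_count _ ul) /degree -(cardsID [set y in l]).
by congr (_ + _); apply: eq_card => y; rewrite !inE andbC.
Qed.

Lemma card_split l : uniq l -> graph_order G = size l + #|[set y : G | y \notin l]|.
Proof.
move=> ul; rewrite /graph_order -(card_uniqP ul) -(cardC (mem l)).
by congr (_ + _); apply: eq_card => y; rewrite !inE.
Qed.

Fixpoint nonedges x s : nat :=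
  if s is y :: s' then ~~ edge x y + nonedges y s' else 0.

Lemma nonedges_cat x s t :
  nonedges x (s ++ t) = nonedges x s + nonedges (last x s) t.
Proof. by elim: s x => //= y s IH x; rewrite IH addnA. Qed.

Lemma nonedges_rev x s :
  nonedges (last x s) (rev (belast x s)) = nonedges x s.
Proof.
elim: s x => //= y s IH x; rewrite rev_cons -cats1 nonedges_cat IH.
by rewrite last_rev_belast /= addn0 addnC edge_sym.
Qed.

(** One Bondy-Chvatal step at the closing pair. A common neighbour of its ends off the cycle is
    inserted between them. Otherwise their neighbourhoods off the cycle are disjoint, the degree sum
    forces crossing chords [y0 a] and [x b] with [a], [b] consecutive, and reversing the stretch
    from [b] to [y0] trades the closing pair and [a b] for two edges. *)
Lemma ocycle_improve x s :
  uniq (x :: s) -> path ore x s -> ore (last x s) x ->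
  ~~ edge (last x s) x ->
  exists y t, [/\ uniq (y :: t), path ore y t, ore (last y t) y,
    size s <= size t &
    nonedges y t + ~~ edge (last y t) y < nonedges x s + 1].
Proof.
move=> us ps oe ne.
set y0 := last x s in oe ne *.
case: (boolP [exists w, [&& w \notin x :: s, edge x w & edge y0 w]]).
  case/existsP=> w /and3P[ws xw yw]; exists w, (x :: s); split => //=.
  - by move: us ws => /= -> ->.
  - by rewrite ps edge_ore // edge_sym.
  - exact: edge_ore.
  - by rewrite -/y0 yw (edge_sym w) xw /= addn0 addn1.
rewrite negb_exists => /forallP nocommon.
have hd : graph_order G <= degree x + degree y0.
  by move: oe; rewrite /ore (negPf ne) addnC => /andP[].
case: (first_consecutive [rel a b | edge y0 a && edge x b] (x :: s)).
  move=> /= srt.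
  have hf : path [rel a b | edge y0 a ==> ~~ edge x b] x s.
    by apply: sub_path srt => a b /=; rewrite negb_and implybE.
  have := count_followed hf; rewrite -/y0 edge_irrefl addn0 => hc.
  (* The vertex [x] is a nonneighbour of itself outside [s]; this unit brings the degree sum below
     the order. *)
  have hx : count (predC (edge x)) (x :: s) =
            (count (predC (edge x)) s).+1 by rewrite /= edge_irrefl.
  have := count_predC (edge x) (x :: s).
  have := degree_split x us; have := degree_split y0 us.
  have := card_split us.
  have : #|[set y | (y \notin x :: s) && edge x y]| +
         #|[set y | (y \notin x :: s) && edge y0 y]| <=
         #|[set y | y \notin x :: s]|.
    rewrite -cardsUI [X in _ + X](_ : _ = 0) ?addn0.
      apply: subset_leq_card; apply/subsetP=> w.
      by rewrite !in_set => /orP[] /andP[].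
    apply/eqP; rewrite cards_eq0; apply/eqP/setP=> w; rewrite in_set0 !in_set.
    by apply: contraNF (nocommon w) => /andP[/andP[-> ->] /andP[_ ->]].
  by lia.
case=> s1 [a [b [s2 [E /andP[ya xb] _]]]].
case: s1 E => [|x' s1] /= [exa E].
  by move: ne; rewrite exa ya.
subst x' s.
exists x, (s1 ++ a :: rev (b :: s2)).
have y0E : y0 = last b s2 by rewrite /y0 last_cat.
have rE : rev (b :: s2) = y0 :: rev (belast b s2).
  by rewrite lastI rev_rcons y0E.
have lE : last x (s1 ++ a :: rev (b :: s2)) = b.
  by rewrite last_cat /= rev_cons last_rcons.
split.
- by rewrite -?cons_uniq; apply: (perm_uniq_imp _ us); perm_by_count.
- move: ps; rewrite !cat_path rE /= => /andP[-> /and3P[-> _ ps]] /=.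
  by rewrite (edge_ore (x := a)) ?(edge_sym a) // y0E path_revP //; apply: ore_sym.
- by rewrite lE edge_ore // edge_sym.
- by rewrite !size_cat /= size_rev.
- rewrite lE !nonedges_cat rE /= y0E nonedges_rev -y0E.
  by rewrite (edge_sym a y0) ya (edge_sym b x) xb; clear; lia.
Qed.

Lemma ocycle_cycle x s : 1 < size s ->
  uniq (x :: s) -> path ore x s -> ore (last x s) x ->
  exists y t, [/\ uniq (y :: t), path edge y t, edge (last y t) y &
    size s <= size t].
Proof.
have [k] := ubnP (nonedges x s + ~~ edge (last x s) x).
elim: k x s => // k IH x s hk ss us ps oe.
have improve x' s' : uniq (x' :: s') -> path ore x' s' ->
    ore (last x' s') x' -> ~~ edge (last x' s') x' -> size s <= size s' ->
    nonedges x' s' + 1 <= nonedges x s + ~~ edge (last x s) x ->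
    exists y t, [/\ uniq (y :: t), path edge y t, edge (last y t) y &
      size s <= size t].
  move=> u1 p1 o1 n1 sz1 le1.
  have [y [t [u2 p2 o2 sz2 lt2]]] := ocycle_improve u1 p1 o1 n1.
  have lt3 : nonedges y t + ~~ edge (last y t) y < k by clear -lt2 le1 hk; lia.
  have st : 1 < size t by clear -ss sz1 sz2; lia.
  have [y' [t' [u3 p3 e3 sz3]]] := IH y t lt3 st u2 p2 o2.
  by exists y', t'; split => //; clear -sz1 sz2 sz3; lia.
case: (boolP (edge (last x s) x)) => e; last first.
  by apply: (improve _ _ us ps oe e) => //; rewrite e.
case: (first_consecutive [rel a b | ~~ edge a b] (x :: s)) => /=.
  move=> srt; exists x, s; split => //.
  by apply: sub_path srt => a b /=; rewrite negbK.
case=> s1 [a [b [s2 [E nab _]]]].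
have [s1' E1] : exists s1', rcons s1 a = x :: s1'.
  by case: s1 E => [|c s1] /= [-> _]; [exists [::] | exists (rcons s1 a)].
have E2 : s = s1' ++ b :: s2.
  by move: E; rewrite -cat_rcons E1 => -[].
have la : last x s1' = a by rewrite -[last x s1']/(last x (x :: s1')) -E1 last_rcons.
subst s; move: ps oe e; rewrite cat_path last_cat /= la.
move=> /and3P[ps1 oab ps2] oe e.
(* The cycle is rotated so that the nonedge [a], [b] becomes its closing pair. *)
apply: (improve b (s2 ++ x :: s1')).
- by rewrite -?cons_uniq; apply: (perm_uniq_imp _ us); perm_by_count.
- by rewrite cat_path /= ps2 oe ps1.
- by rewrite last_cat /= la.
- by rewrite last_cat /= la.
- by rewrite !size_cat /=; clear; lia.
- by rewrite !nonedges_cat /= last_cat /= la e nab; clear; lia.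
Qed.

End OrePaths.

(** * Induced claws and wounded graphs *)

Section HeavySubgraphs.
Variable G : sgraph.
Implicit Types (x y z : G) (s l : seq G).

Lemma heavy_copy_ore n (es : seq (nat * nat)) (f : 'I_n -> G) :
  H_heavy (elist_graph n es) G -> injective f ->
  (forall i j, edge (f i) (f j) = elist_edge es i j) ->
  exists i j, [/\ i != j, ~~ elist_edge es i j & ore (f i) (f j)].
Proof.
move=> hv fi fe.
set S := [set f i | i : 'I_n].
have fS i : f i \in S by apply: imset_f.
pose h i : {x : G | x \in S} := exist _ (f i) (fS i).
have hi : injective h by move=> i j [] /fi.
have hb : bijective h.
  by apply: inj_card_bij => //; rewrite card_sig card_imset ?card_ord.
have [g hK gK] := hb.
have iso : isomorphic (induced S) (elist_graph n es).
  exists g; first by exists h.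
  move=> x y; rewrite -[in RHS](gK x) -[in RHS](gK y).
  by symmetry; apply: fe.
have [x [y [/imsetP[i _ ->] /imsetP[j _ ->] nij ne hd]]] := hv S iso.
exists i, j; split.
- by apply: contraNneq nij => ->.
- by rewrite -fe.
- by rewrite /ore /graph_order nij hd orbT.
Qed.

Lemma claw_ore c x y z : H_heavy claw G ->
  edge c x -> edge c y -> edge c z -> x != y -> x != z -> y != z ->
  [|| ore x y, ore x z | ore y z].
Proof.
move=> hv cx cy cz xy xz yz; apply/negPn/negP.
rewrite !negb_or => /and3P[nxy nxz nyz].
pose vs := [:: c; x; y; z].
have uvs : uniq vs by rewrite /= !inE !negb_or xy xz yz !edge_neq.
have [|i j|i [j []]] := @heavy_copy_ore 4 _ (fun i => nth c vs i) hv.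
- by move=> i j /eqP; rewrite nth_uniq // => /eqP/val_inj.
- have := oreNedge nxy; have := oreNedge nxz; have := oreNedge nyz.
  move=> /negPf e1 /negPf e2 /negPf e3.
  case: i => [[|[|[|[|//]]]] hi]; case: j => [[|[|[|[|//]]]] hj];
  by rewrite /elist_edge /= ?edge_irrefl ?cx ?cy ?cz ?e1 ?e2 ?e3 // edge_sym.
- case: i => [[|[|[|[|//]]]] hi]; case: j => [[|[|[|[|//]]]] hj] //= _ _;
  by rewrite ?(negPf nxy) ?(negPf nxz) ?(negPf nyz) // ore_sym
     ?(negPf nxy) ?(negPf nxz) ?(negPf nyz).
Qed.

(* Distinctness of the six vertices follows from the other hypotheses. *)
Lemma wounded_ore (a b c a' b' b'' : G) : H_heavy wounded G ->
  edge a b -> edge a c -> edge b c -> edge a a' -> edge b b' -> edge b' b'' ->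
  ~~ ore a b' -> ~~ ore a b'' -> ~~ ore b a' -> ~~ ore b b'' ->
  ~~ ore c a' -> ~~ ore c b' -> ~~ ore c b'' ->
  ~~ ore a' b' -> ~~ ore a' b'' -> False.
Proof.
move=> hv ab ac bc aa bb bbb n1 n2 n3 n4 n5 n6 n7 n8 n9.
pose vs := [:: a; b; c; a'; b'; b''].
have neq (x y z : G) : edge x z -> ~~ ore y z -> x != y.
  by move=> xz; apply: contraNneq => <-; apply: edge_ore.
have neq' (x y z : G) : edge z x -> ~~ ore z y -> x != y.
  by move=> xz; apply: contraNneq => <-; apply: edge_ore.
have ba : edge b a by rewrite edge_sym.
have ca : edge c a by rewrite edge_sym.
have cb : edge c b by rewrite edge_sym.
have nn (x y : G) : ~~ ore x y -> ~~ ore y x by rewrite ore_sym.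
have uvs : uniq vs.
  rewrite /= !inE !negb_or.
  have -> : a != b by apply: edge_neq.
  have -> : a != c by apply: edge_neq.
  have -> : a != a' by apply: edge_neq.
  have -> : a != b' by rewrite eq_sym; apply: neq bbb n2.
  have -> : a != b'' by apply: neq' ba n4.
  have -> : b != c by apply: edge_neq.
  have -> : b != a' by apply: neq' cb n5.
  have -> : b != b' by apply: edge_neq.
  have -> : b != b'' by apply: neq' ab n2.
  have -> : c != a' by apply: neq' bc n3.
  have -> : c != b' by apply: neq' ac n1.
  have -> : c != b'' by apply: neq' ac n2.
  have -> : a' != b' by apply: neq' aa n1.
  have -> : a' != b'' by apply: neq' aa n2.
  by rewrite edge_neq.
have [|i j|i [j []]] := @heavy_copy_ore 6 _ (fun i => nth a vs i) hv.
- by move=> i j /eqP; rewrite nth_uniq // => /eqP/val_inj.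
- have ne (x y : G) : ~~ ore x y -> edge x y = false by move/oreNedge/negPf.
  have ne' (x y : G) : ~~ ore x y -> edge y x = false by rewrite edge_sym; apply: ne.
  case: i => [[|[|[|[|[|[|//]]]]]] hi]; case: j => [[|[|[|[|[|[|//]]]]]] hj];
  rewrite /elist_edge /=; first [exact: edge_irrefl | assumption
    | by rewrite edge_sym | exact: ne | exact: ne'].
- case: i => [[|[|[|[|[|[|//]]]]]] hi]; case: j => [[|[|[|[|[|[|//]]]]]] hj];
  move=> //= _ _; apply/negP; first [assumption | by rewrite ore_sym].
Qed.

End HeavySubgraphs.

(** * A longest cycle with a component outside it *)

(** Maximality is stated for closed [ore]-paths, so that reroutings may use heavy pairs freely. Only
    the vertex set of the longest cycle is kept; the cyclic order is supplied by [theta]. *)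
Record obstruction (G : sgraph) (C H : {set G}) : Prop := Obstruction {
  obs_claw : H_heavy claw G;
  obs_wounded : H_heavy wounded G;
  obs_max : forall (x y : G) l, opath x y l -> ore y x -> uniq l -> size l <= #|C|;
  obs_disjoint : forall z, z \in H -> z \notin C;
  obs_connected : forall z z', z \in H -> z' \in H ->
    exists s, [/\ path edge z s, last z s = z' & {subset s <= H}];
  obs_closed : forall z w, z \in H -> edge z w -> w \notin C -> w \in H }.

Arguments obs_max {G C H} _ [x y l].
Arguments obs_disjoint {G C H} _ [z].
Arguments obs_connected {G C H} _ [z z'].
Arguments obs_closed {G C H} _ [z w].

Section Theta.
Variables (G : sgraph) (C H : {set G}).
Implicit Types (x y z u v a b : G) (s l r t : seq G).
Hypothesis obs : obstruction C H.

(* The cycle is [u :: s1 ++ v :: rev s2], and [r] is the inside of a path from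
   [u] to [v] through [H]; all three paths are listed from [u] to [v], which
   makes the data symmetric under [theta_flip] and [theta_swap]. *)
Record theta u v s1 s2 r : Prop := Theta {
  theta_path1 : path edge u (rcons s1 v);
  theta_path2 : path edge u (rcons s2 v);
  theta_pathH : path edge u (rcons r v);
  theta_uniq : uniq (u :: v :: s1 ++ s2);
  theta_uniqH : uniq r;
  theta_C : u :: v :: s1 ++ s2 =i C;
  theta_H : {subset r <= H};
  theta_nil : r != [::] }.

Lemma theta_flip u v s1 s2 r : theta u v s1 s2 r -> theta u v s2 s1 r.
Proof.
case=> p1 p2 p3 us ur cC rH rn; split=> //.
- by apply: (perm_uniq_imp _ us); perm_by_count.
- by move=> x; rewrite -cC !inE !mem_cat [(x \in s2) || _]orbC.
Qed.

Lemma theta_swap u v s1 s2 r :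
  theta u v s1 s2 r -> theta v u (rev s1) (rev s2) (rev r).
Proof.
case=> p1 p2 p3 us ur cC rH rn; split.
- exact: (rcons_path_rev (@edge_sym G) p1).
- exact: (rcons_path_rev (@edge_sym G) p2).
- exact: (rcons_path_rev (@edge_sym G) p3).
- by apply: (perm_uniq_imp _ us); perm_by_count.
- by rewrite rev_uniq.
- by move=> x; rewrite -cC !inE !mem_cat !mem_rev orbCA.
- by move=> x; rewrite mem_rev; apply: rH.
- by move: rn; rewrite -!size_eq0 size_rev.
Qed.

Lemma theta_card u v s1 s2 r : theta u v s1 s2 r ->
  #|C| = (size s1 + size s2).+2.
Proof.
case=> _ _ _ us _ cC _ _.
by rewrite -(eq_card cC) (card_uniqP us) /= size_cat.
Qed.

(** Common end of the reroutings below: [t] is what the new closed path picks up outside the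
    cycle. *)
Lemma no_longer u v s1 s2 r x y l t : theta u v s1 s2 r ->
  opath x y l -> ore y x -> perm_eq l (u :: v :: s1 ++ s2 ++ t) ->
  uniq t -> {in t, forall z, z \notin C} -> t != [::] -> False.
Proof.
move=> th pl oyx pe ut tC tn.
have sz : size l = (size s1 + (size s2 + size t)).+2.
  by rewrite (perm_size pe) /= !size_cat.
have ul : uniq l.
  apply: (perm_uniq_imp pe); rewrite !catA -!cat_cons cat_uniq ut andbT.
  rewrite (theta_uniq th) /= -all_predC; apply/allP=> z /tC.
  by rewrite /= (theta_C th).
have := obs_max obs pl oyx ul; rewrite sz (theta_card th).
have : 0 < size t by case: t tn {pe sz ut tC}.
by clear; lia.
Qed.

(** If [u] and [v] were consecutive on the cycle, [r] could be inserted between them. *)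
Lemma theta_cons u v s1 s2 r : theta u v s1 s2 r -> exists x s, s1 = x :: s.
Proof.
move=> th; case E: s1 => [|x s]; last by exists x, s.
exfalso; subst s1.
have := theta_path1 th; rewrite /= andbT => uv.
have := theta_pathH th; rewrite rcons_path => /andP[p3 e3].
have := rcons_path_rev (@edge_sym G) (theta_path2 th).
rewrite rcons_path => /andP[p2 e2].
apply: (no_longer (t := r) th
  (opath_extend (opath_path (edge_path_ore p3)) (s := v :: rev s2) _)).
- by rewrite /= edge_ore // edge_path_ore.
- by rewrite /= edge_ore.
- by perm_by_count.
- exact: theta_uniqH th.
- by move=> z /(theta_H th)/(obs_disjoint obs).
- exact: theta_nil th.
Qed.

Lemma theta_to_H u v s1 s2 r z : theta u v s1 s2 r -> z \in H ->
  exists t, [/\ path edge u (rcons t z), uniq (rcons t z)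
    & {subset rcons t z <= H}].
Proof.
move=> th zH; have := theta_pathH th; have := theta_nil th.
have := theta_H th.
case: r {th} => // z0 r rH _ /= /andP[e0 _].
have z0H : z0 \in H by apply: rH; rewrite mem_head.
have [s [ps ls sH]] := obs_connected obs z0H zH.
case/shortenP: ps ls => s' ps' us' ss' ls.
exists (belast z0 s'); rewrite -ls -lastI; split => //=; first by rewrite e0.
by move=> y; rewrite inE => /predU1P[-> //|/ss'/sH].
Qed.

Lemma path_rcons_cat (e : rel G) u v s t :
  path e u (rcons (s ++ t) v) -> path e u s /\ path e (last u s) (rcons t v).
Proof. by rewrite rcons_cat cat_path => /andP. Qed.

(** Otherwise: cross the arc from [u] to the end of [tm], follow [B] to [v], return along [A2] to
    [a], jump to [z], and go through the component to [u]. *)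
Lemma frontier_H u v A1 a A2 tm B r z :
  theta u v (A1 ++ a :: A2) (tm ++ B) r ->
  opath u (last u tm) (u :: A1 ++ tm) -> z \in H -> ~~ ore a z.
Proof.
move=> th pu zH; apply/negP=> oaz.
have [t [pt ut tH]] := theta_to_H th zH.
have [_ pB] := path_rcons_cat (theta_path2 th).
have := rcons_path_rev (@edge_sym G) (theta_path1 th).
rewrite rev_cat => /path_rcons_cat[pA _].
have := rcons_path_rev (@edge_sym G) pt; rewrite rcons_path => /andP[pz ez].
have pl : path (@ore G) (last u tm) (rcons B v ++ rev (a :: A2)).
  by rewrite edge_path_ore // cat_path pB last_rcons.
have := opath_extend pu pl.
rewrite last_cat last_rcons rev_cons last_rcons => pua.
apply: (no_longer (t := rcons t z) th
  (opath_cat pua oaz (opath_path (edge_path_ore pz)))) => //.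
- exact: edge_ore.
- by perm_by_count.
- by move=> y /tH/(obs_disjoint obs).
- by rewrite -size_eq0 size_rcons.
Qed.

Lemma opath_nil u : opath u (last u [::]) (u :: [::] ++ [::]).
Proof. exact: opath1. Qed.

(** In the claw at [u] with leaves [x], [y] and a neighbour in the component, [frontier_H] leaves
    only this pair. It lets a rerouting bypass the root. *)
Lemma ends_ore u v x s1 y s2 r : theta u v (x :: s1) (y :: s2) r -> ore x y.
Proof.
move=> th.
have [z [zH uz]] : exists z, z \in H /\ edge u z.
  case: r th => [|z r] th; first by have := theta_nil th.
  exists z; split; first by apply: (theta_H th); rewrite mem_head.
  by have /andP[] := theta_pathH th.
have ux : edge u x by have /andP[] := theta_path1 th.
have uy : edge u y by have /andP[] := theta_path2 th.
have nx := frontier_H (A1 := [::]) (tm := [::]) th (opath_nil u) zH.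
have ny := frontier_H (A1 := [::]) (tm := [::]) (theta_flip th) (opath_nil u) zH.
have zx w : w \in C -> z != w by apply: contraTneq => <-; apply: (obs_disjoint obs).
have := claw_ore (obs_claw obs) uz ux uy.
rewrite ![ore z _]ore_sym (negPf nx) (negPf ny) /=; apply.
- by apply: zx; rewrite -(theta_C th) !inE eqxx !orbT.
- by apply: zx; rewrite -(theta_C th) !(inE, mem_cat) eqxx !orbT.
- have := theta_uniq th; rewrite /= !inE !mem_cat !inE.
  by move=> /and3P[_ _ /andP[+ _]]; rewrite !negb_or => /and3P[].
Qed.

(** Otherwise: [u], [r], the arc of [v] up to the end of [yp], [M] backwards to the cycle neighbour
    of [u], over to the other cycle neighbour by [ends_ore], on to [b], and back to [u]. *)
Lemma root_frontier u v M yp s2 B1 b B2 r :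
  theta u v (M ++ rev yp) s2 r -> M != [::] -> rev s2 = B1 ++ b :: B2 ->
  opath v (last v yp) (v :: yp ++ B1) -> ~~ ore u b.
Proof.
move=> th + Es pv; case: M th => // x M th _; apply/negP=> oub.
have E2 : s2 = last b B2 :: rev (belast b B2) ++ rev B1.
  by rewrite -[s2]revK Es rev_cat lastI rev_rcons.
have oxy : ore x (last b B2) by move: th; rewrite E2; apply: ends_ore.
have := rcons_path_rev (@edge_sym G) (theta_path1 th).
rewrite rev_cat revK => /path_rcons_cat[_]; rewrite rcons_path => /andP[pM _].
have := theta_pathH th; rewrite rcons_path => /andP[p3 e3].
have := rcons_path_rev (@edge_sym G) (theta_path2 th).
rewrite Es => /path_rcons_cat[_] /= /andP[_]; rewrite rcons_path => /andP[pB _].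
have := opath_cat (opath_path (edge_path_ore p3)) (edge_ore e3) pv.
move/opath_extend/(_ (edge_path_ore pM)); rewrite rev_cons last_rcons => p4.
have := opath_path (path_revP (@ore_sym G) (edge_path_ore pB)).
move/(opath_cat p4 oxy); rewrite last_rev_belast => p5.
apply: (no_longer (t := r) th p5) => //.
- by rewrite ore_sym.
- by rewrite -rev_rcons -lastI -[s2]revK Es; perm_by_count.
- exact: theta_uniqH th.
- by move=> z /(theta_H th)/(obs_disjoint obs).
- exact: theta_nil th.
Qed.

(** Otherwise: from the end of [tm] across the arc to [u], [r], [v], across its arc to the end of
    [yp], [A2] backwards to [a], jump to [b], and [B2] to the end of [tm]. *)
Lemma frontier_opposite u v A1 a A2 yp tm B1 b B2 s2 r :
  theta u v (A1 ++ a :: A2 ++ rev yp) s2 r ->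
  rev s2 = B1 ++ b :: B2 ++ rev tm ->
  opath u (last u tm) (u :: A1 ++ tm) ->
  opath v (last v yp) (v :: yp ++ B1) -> ~~ ore a b.
Proof.
move=> th Es pu pv; apply/negP=> oab.
have := theta_pathH th; rewrite rcons_path => /andP[p3 e3].
have := rcons_path_rev (@edge_sym G) (theta_path1 th).
rewrite -cat_cons catA rev_cat revK => /path_rcons_cat[_].
rewrite rev_cat => /path_rcons_cat[pA _].
have := rcons_path_rev (@edge_sym G) (theta_path2 th).
rewrite Es => /path_rcons_cat[_] /=.
rewrite rcons_cat -rev_cons lastI rev_rcons cat_path /= => /and3P[_ pB /andP[eB _]].
have := opath_extend (opath_sym pu) (edge_path_ore p3).
move/opath_cat/(_ (edge_ore e3) pv)/opath_extend/(_ (edge_path_ore pA)).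
rewrite rev_cons last_rcons => p4.
have p5 := opath_cat p4 oab (opath_path (edge_path_ore pB)).
apply: (no_longer (t := r) th p5) => //.
- exact: edge_ore.
- by rewrite -[s2]revK Es; perm_by_count.
- exact: theta_uniqH th.
- by move=> z /(theta_H th)/(obs_disjoint obs).
- exact: theta_nil th.
Qed.

(** With the arcs meeting on the first side, one closed path crosses both of them and uses only [r]
    and [P] in between. *)
Lemma balls_apart u v tp yp tm P ym r :
  theta u v (tp ++ rev yp) (tm ++ P ++ rev ym) r ->
  opath u (last u tm) (u :: tp ++ tm) ->
  opath v (last v ym) (v :: yp ++ ym) -> False.
Proof.
move=> th pu pv.
have := theta_pathH th; rewrite rcons_path => /andP[p3 e3].
have := rcons_path_rev (@edge_sym G) (theta_path2 th).
rewrite !rev_cat revK -catA => /path_rcons_cat[_].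
rewrite rcons_cat -rev_cons lastI rev_rcons cat_path /= => /and3P[pP eP _].
have := opath_extend (opath_sym pu) (edge_path_ore p3).
move/opath_cat/(_ (edge_ore e3) pv)/opath_extend/(_ (edge_path_ore pP)) => p4.
apply: (no_longer (t := r) th p4) => //.
- exact: edge_ore.
- by perm_by_count.
- exact: theta_uniqH th.
- by move=> z /(theta_H th)/(obs_disjoint obs).
- exact: theta_nil th.
Qed.

End Theta.

(** * Heavy pairs between the cycle and the component *)

Section DegreeSums.
Variables (G : sgraph) (C H : {set G}).
Implicit Types (x y z u v a b : G) (s l r t : seq G).
Hypothesis obs : obstruction C H.
Local Notation theta := (theta C H).

Lemma theta_cycle u v s1 s2 r : theta u v s1 s2 r ->
  ucycle edge (u :: s1 ++ v :: rev s2).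
Proof.
move=> th; apply/andP; split; last first.
  by apply: (perm_uniq_imp _ (theta_uniq th)); perm_by_count.
have := theta_path1 th; rewrite rcons_path => /andP[p1 e1].
have := rcons_path_rev (@edge_sym G) (theta_path2 th) => p2.
by rewrite /= rcons_cat /= cat_path p1 /= e1.
Qed.

Section Unattached.
Variables (y z : G) (c : seq G).
Hypothesis cyc : ucycle edge (y :: c).
Hypothesis cC : y :: c =i C.
Hypothesis zH : z \in H.
Hypothesis yH : {in H, forall w, ~~ edge y w}.

Let insert s : path (@ore G) z s -> ore (last z s) z -> perm_eq s (y :: c) ->
  False.
Proof.
move=> ps os pe.
have us : uniq (z :: s).
  rewrite /= (perm_mem pe) cC (obs_disjoint obs) //= (perm_uniq pe).
  by case/andP: cyc.
have := obs_max obs (opath_path ps) os us.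
have : size s = #|C|.
  rewrite (perm_size pe) -(eq_card cC); apply/esym/card_uniqP.
  by case/andP: cyc.
by move=> /= -> ; rewrite ltnn.
Qed.

(** Outside the cycle, [z] sees only the component and [y] sees none of it. Of the surplus 2, one
    unit comes from [z] missing itself in the component, the other from the cycle vertex [y],
    adjacent to neither [y] nor [z]. *)
Let balance : ore z y -> count (predC (edge y)) c + 2 <= count (edge z) c.
Proof.
have uyc : uniq (y :: c) by case/andP: cyc.
have nzy : ~~ edge z y by rewrite edge_sym yH.
move=> ozy; have hd := ore_degree ozy nzy.
have := degree_split y uyc; have := degree_split z uyc.
have := card_split uyc.
set Out := [set w | w \notin y :: c].
set oz := #|[set w | _ && edge z w]|; set oy := #|[set w | _ && edge y w]|.
have HO : H \subset Out.
  by apply/subsetP=> w wH; rewrite inE cC (obs_disjoint obs).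
have hz : oz < #|H|.
  rewrite /oz (cardsD1 z H) zH add1n ltnS; apply: subset_leq_card.
  apply/subsetP=> w; rewrite in_setD1 in_set cC => /andP[wC zw].
  rewrite (obs_closed obs zH zw wC) andbT.
  by apply: contraTneq zw => ->; rewrite edge_irrefl.
have hy : oy <= #|Out :\: H|.
  apply: subset_leq_card; apply/subsetP=> w; rewrite !in_set => /andP[-> yw].
  by rewrite andbT; apply: contraL yw => /yH.
have := cardsD Out H; rewrite (setIidPr HO) => hD.
have := subset_leq_card HO.
have := count_predC (edge y) c.
rewrite /= edge_irrefl (negPf nzy).
by move: hd hz hy hD; clear; lia.
Qed.

(* Counting along the cycle yields neighbours [a2], [a1] of [z], in this order
   after [y], such that [y] is adjacent to the successor of [a2] and to the
   predecessor of [a1].  By the claw at [y], one of three reroutings then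
   inserts [z] into the cycle. *)
Lemma unattached_nore_cycle : ~~ ore z y.
Proof.
apply/negP=> ozy; have := balance ozy.
have uyc : uniq (y :: c) by case/andP: cyc.
have : path edge y (rcons c y) by case/andP: cyc.
rewrite rcons_path => /andP[pc elast].
case: (first_consecutive [rel a b | edge z a && edge y b] c).
  case: c pc elast => [|h c'] //= _ _ srt.
  have hf : path [rel a b | edge z a ==> ~~ edge y b] h c'.
    by apply: sub_path srt => a b /=; rewrite negb_and implybE.
  by have := count_followed hf; clear; rewrite /=; lia.
case=> c1 [a2 [w [c2 [Ec /andP[/= za2 yw] srt]]]].
have [h [c1' Eh]] : exists h c1', rcons c1 a2 = h :: c1'.
  by case: (c1) => [|h c1']; [exists a2, [::] | exists h, (rcons c1' a2)].
have lh : last h c1' = a2 by rewrite -[RHS](last_rcons h c1 a2) Eh.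
move: srt; rewrite Eh /= => srt.
have hf : path [rel a b | edge z a ==> ~~ edge y b] h c1'.
  by apply: sub_path srt => a b /=; rewrite negb_and implybE.
(* As [a2], [w] is the first such pair, the stretch up to [a2] consumes at most one of the two
   surplus units; the other forces the second pair beyond [w]. *)
have := count_followed hf.
move: Ec; rewrite -cat_rcons Eh => Ec.
move: pc elast uyc; rewrite Ec /= cat_path last_cat /= lh.
move=> /and4P[eyh ph eaw pw] elast uyc.
have nzw : ~~ edge z w.
  apply/negP=> zw; apply: (@insert (w :: c2 ++ y :: h :: c1')).
  - by rewrite edge_path_ore //= zw cat_path pw /= elast eyh ph.
  - by rewrite /= last_cat /= lh edge_ore // edge_sym.
  - by rewrite Ec; perm_by_count.
case: (first_consecutive [rel a b | edge y a && edge z b] (w :: c2)).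
  move=> /= srt2.
  have hf2 : path [rel a b | edge y a ==> ~~ edge z b] w c2.
    by apply: sub_path srt2 => a b /=; rewrite negb_and implybE.
  have := count_preceded hf2.
  rewrite /= !count_cat /= (negPf nzw).
  by case: (edge z _) => /=; clear; lia.
case=> D [e [a1 [d2 [Ew /andP[/= ye za1] _]]]] _ _.
have [D' [ED lD]] : exists D', rcons D e = w :: D' /\ last w D' = e.
  case: D Ew => [|w' D] /= [-> _]; first by exists [::].
  by exists (rcons D e); rewrite last_rcons.
move: Ew; rewrite -cat_rcons ED => -[Ec2]; subst c2.
move: pw elast; rewrite cat_path last_cat /= lD.
move=> /and3P[pD ea1 pd2] elast.
set ym := last a1 d2 in elast.
have ymd : ym \in a1 :: d2 by apply: mem_last.
have yh : edge y h := eyh.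
have yym : edge y ym by rewrite edge_sym.
have uall : uniq ((h :: c1') ++ (w :: D') ++ (a1 :: d2)).
  by case/andP: uyc.
have nhw : h != w.
  by move: uall; rewrite /= mem_cat /= inE !negb_or => /andP[/and3P[]].
have nhy : h != ym.
  apply: contraTneq uall => ->; rewrite /= mem_cat /=.
  by rewrite -cat_cons mem_cat ymd !orbT.
have nwy : w != ym.
  apply: contraTneq uall => ->; rewrite cat_uniq.
  by rewrite [uniq (_ ++ (a1 :: d2))]/= mem_cat ymd orbT !andbF.
have := claw_ore (obs_claw obs) yh yw yym nhw nhy nwy.
have ezy := edge_ore za2; rewrite ore_sym in ezy.
case/or3P.
- move=> ohw.
  apply: (@insert (y :: rev (w :: D' ++ a1 :: d2) ++ h :: c1')).
  + have ymE : ym = last w (D' ++ a1 :: d2) by rewrite last_cat.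
    rewrite (lastI w) rev_rcons -ymE /= ozy (edge_ore yym) cat_path ymE.
    rewrite (path_revP (@ore_sym G)) /=; last first.
      by rewrite edge_path_ore // cat_path pD /= lD ea1.
    by rewrite last_rev_belast ore_sym ohw edge_path_ore.
  + by rewrite /= last_cat /= lh.
  + by rewrite Ec; perm_by_count.
- move=> ohy.
  apply: (@insert (y :: w :: (D' ++ a1 :: d2) ++ h :: c1')).
  + rewrite /= ozy (edge_ore yw) !cat_path last_cat /= -/ym lD.
    by rewrite !edge_path_ore //= (edge_ore ea1) ore_sym ohy.
  + by rewrite /= last_cat /= lh.
  + by rewrite Ec; perm_by_count.
- move=> owy.
  apply: (@insert (a1 :: d2 ++ (w :: D') ++ y :: h :: c1')).
  + rewrite /= (edge_ore za1) !cat_path /= -/ym cat_path /= lD.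
    rewrite !edge_path_ore //= ore_sym owy (edge_ore (x := e)) 1?edge_sym //.
    by rewrite (edge_ore eyh).
  + by rewrite /= last_cat /= last_cat /= lh.
  + by rewrite Ec; perm_by_count.
Qed.

End Unattached.

Lemma unattached_nore u v s1 s2 r y z : theta u v s1 s2 r -> y \in C ->
  {in H, forall w, ~~ edge y w} -> z \in H -> ~~ ore z y.
Proof.
move=> th yC yH zH.
have cyc := theta_cycle th.
have cC : u :: s1 ++ v :: rev s2 =i C.
  move=> x; rewrite -(theta_C th) !(inE, mem_cat, mem_rev).
  by congr (_ || _); apply: orbCA.
have [c [cyc' pe]] := ucycle_rot_to cyc (etrans (cC y) yC).
apply: (unattached_nore_cycle cyc' _ zH yH).
by move=> x; rewrite (perm_mem pe) cC.
Qed.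

End DegreeSums.

(** * Neighbours of a root on the cycle *)

Section Consecutive.
Variables (G : sgraph) (C H : {set G}).
Implicit Types (x y z u v w a b : G) (s l r t : seq G).
Hypothesis obs : obstruction C H.
Local Notation theta := (theta C H).
Local Notation path_ore := (path (@ore G)).

Lemma clique_path x s : uniq (x :: s) ->
  {in x :: s &, forall a b, a != b -> ore a b} -> path_ore x s.
Proof.
elim: s x => //= y s IH x /andP[]; rewrite inE negb_or => /andP[xy xs] us cl.
rewrite cl ?inE ?eqxx ?orbT //=; apply: IH => // a b aI bI.
by apply: cl; rewrite inE ?aI ?bI orbT.
Qed.

Lemma theta_notC u v s1 s2 r z : theta u v s1 s2 r -> z \notin C ->
  [/\ z != u, z != v, z \notin s1 & z \notin s2].
Proof.
move=> th; rewrite -(theta_C th) !inE mem_cat !negb_or.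
by case/and4P.
Qed.

Lemma theta_H_root u v s1 s2 r : theta u v s1 s2 r ->
  exists2 z, z \in H & edge u z.
Proof.
case: r => [|z r] th; first by have := theta_nil th.
exists z; first by apply: (theta_H th); rewrite mem_head.
by have /andP[] := theta_pathH th.
Qed.

Lemma theta_head u v x s1 s2 r : theta u v (x :: s1) s2 r -> edge u x.
Proof. by case/theta_path1/andP. Qed.

Lemma head_H u v x s1 s2 r z : theta u v (x :: s1) s2 r -> z \in H ->
  ~~ ore x z.
Proof.
by move=> th; apply: (frontier_H obs (A1 := [::]) (tm := [::]) th (opath1 u)).
Qed.

Lemma last_other_nore u v s1 s x r : theta u v s1 (rcons s x) r -> ~~ ore u x.
Proof.
move=> th; have [y [s' E]] := theta_cons obs th; subst s1.
have th' : theta u v ((y :: s') ++ rev [::]) (rcons s x) r by rewrite cats0.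
have E : rev (rcons s x) = [::] ++ x :: rev s by rewrite rev_rcons.
by apply: (root_frontier obs th' isT E); apply: opath1.
Qed.

(** Claw at [u] with one leaf [z] in the component: [z] is unrelated to [s1] by [unattached_nore],
    and to the cycle neighbour [x] by rerouting. *)
Lemma nbr_clique u v s1 x s2 r : theta u v s1 (x :: s2) r ->
  {in s1 & H, forall a z, ~~ edge a z} ->
  {in x :: s1 &, forall a b, edge u a -> edge u b -> a != b -> ore a b}.
Proof.
move=> th free a b aI bI ua ub ab.
have [z zH uz] := theta_H_root th.
have nz c : c \in x :: s1 -> (z != c) && ~~ ore z c.
  rewrite inE => /predU1P[->|cI].
    rewrite ore_sym (head_H (theta_flip th) zH) andbT.
    apply: contraTneq (obs_disjoint obs zH) => ->.
    by rewrite negbK -(theta_C th) !(inE, mem_cat) eqxx !orbT.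
  have cC : c \in C by rewrite -(theta_C th) !(inE, mem_cat) cI !orbT.
  rewrite (unattached_nore obs th cC _ zH); last by move=> w; apply: free.
  by rewrite andbT; apply: contraTneq cC => <-; apply: obs_disjoint zH.
have /andP[za nza] := nz _ aI; have /andP[zb nzb] := nz _ bI.
have := claw_ore (obs_claw obs) uz ua ub za zb ab.
by rewrite (negPf nza) (negPf nzb).
Qed.

(** Otherwise: [u], through the component to [z], [a], back to [v], back along [s1] to the neighbour
    of [u], over by [ends_ore] to the end of [l2], back to [b], and [u]. *)
Lemma nbr_after_attached u v s1 s2 r z l1 a b l2 : theta u v s1 s2 r ->
  z \in H -> v :: rev s2 = l1 ++ a :: b :: l2 -> edge z a -> ~~ ore u b.
Proof.
move=> th zH E za; apply/negP=> oub.
have [x [s1' E1]] := theta_cons obs th; subst s1.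
have [t [pt ut tH]] := theta_to_H obs th zH.
have := rcons_path_rev (@edge_sym G) (theta_path1 th).
rewrite rcons_path => /andP[p1 _].
have := rcons_path_rev (@edge_sym G) (theta_path2 th).
rewrite rcons_path => /andP[p2 _].
have [l1' El] : exists l1', rcons l1 a = v :: l1'.
  by case: (l1) E => [|c l] /= [-> _]; [exists [::] | exists (rcons l a)].
move: E; rewrite -cat_rcons El => -[E].
have la : last v l1' = a by rewrite -[LHS]/(last v (v :: l1')) -El last_rcons.
have Es : s2 = last b l2 :: rev (belast b l2) ++ rev l1'.
  by rewrite -[s2]revK E rev_cat lastI rev_rcons.
move: p2; rewrite E cat_path la /= => /and3P[p2 _ p3].
have oxy : ore x (last b l2) by move: th; rewrite Es; apply: ends_ore.
have oza : ore (last u (rcons t z)) a by rewrite last_rcons edge_ore.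
have q1 := opath_path (path_revP (@ore_sym G) (edge_path_ore p2)).
rewrite last_rev_belast la in q1.
have := opath_extend (opath_cat (opath_path (edge_path_ore pt)) oza q1)
  (edge_path_ore p1); rewrite rev_cons last_rcons => q3.
have := opath_cat q3 oxy
  (opath_path (path_revP (@ore_sym G) (edge_path_ore p3))).
rewrite last_rev_belast => q4.
apply: (no_longer obs (t := rcons t z) th q4) => //.
- by rewrite ore_sym.
- rewrite -[s2]revK E.
  have -> : last b l2 :: rev (belast b l2) = rev (b :: l2).
    by rewrite rev_last.
  have -> : a :: rev (belast v l1') = rev (v :: l1').
    by rewrite rev_last la.
  by perm_by_count.
- by move=> w /tH/(obs_disjoint obs).
- by rewrite -size_eq0 size_rcons.
Qed.

End Consecutive.

(** * The root and its nonneighbours in the component *)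

Section RootNore.
Variables (G : sgraph) (C H : {set G}).
Implicit Types (x y z u v w a b : G) (s l r t : seq G).
Hypothesis obs : obstruction C H.
Local Notation theta := (theta C H).
Local Notation path_ore := (path (@ore G)).

Lemma outside_head_nore u v x s1 s2 r w : theta u v (x :: s1) s2 r ->
  w \notin C -> edge u w -> ~~ ore w x.
Proof.
move=> th wC uw; apply/negP=> owx.
have := theta_path1 th; rewrite rcons_path => /andP[p1 e1].
have := rcons_path_rev (@edge_sym G) (theta_path2 th).
rewrite rcons_path => /andP[p2 e2].
have p : path_ore u (w :: x :: s1 ++ v :: rev s2).
  have /andP[_ p1'] : edge u x && path edge x s1 by [].
  rewrite /= (edge_ore uw) owx cat_path edge_path_ore //= edge_path_ore //.
  by rewrite edge_ore //; move: e1.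
apply: (no_longer obs (t := [:: w]) th (opath_path p)) => //.
- by rewrite /= last_cat /= edge_ore.
- by perm_by_count.
- by move=> y; rewrite inE => /eqP ->.
Qed.

(** The third leaf of the claw at [u] is its successor [x] on the cycle; a vertex off the cycle
    related to [x] could be inserted between [u] and [x]. *)
Lemma outside_clique u v s1 s2 r : theta u v s1 s2 r ->
  {in [predC C] &, forall a b, edge u a -> edge u b -> a != b -> ore a b}.
Proof.
move=> th a b aC bC ua ub ab.
have [x [s E]] := theta_cons obs th; subst s1.
have ne w : w \notin C -> w != x by move/(theta_notC th) => [_ _]; rewrite inE negb_or => /andP[].
have := claw_ore (obs_claw obs) ua ub (theta_head th) ab (ne _ aC) (ne _ bC).
rewrite (negPf (outside_head_nore th aC ua)).
by rewrite (negPf (outside_head_nore th bC ub)) !orbF.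
Qed.

Lemma theta_degree u v s1 s2 r w : theta u v s1 s2 r ->
  degree w = edge w u + edge w v + count (edge w) s1 + count (edge w) s2
             + #|[set y | (y \notin C) && edge w y]|.
Proof.
move=> th; rewrite (degree_split _ (theta_uniq th)) /= count_cat !addnA.
by congr (_ + _); apply: eq_card => y; rewrite !in_set (theta_C th).
Qed.

Lemma theta_order u v s1 s2 r : theta u v s1 s2 r ->
  graph_order G = (size s1 + size s2).+2 + #|~: C|.
Proof. by move=> th; rewrite /graph_order -(cardsC C) (theta_card th). Qed.

Lemma opath_clique u s t x : path_ore u (rcons s x) -> path_ore x t ->
  opath u (last x t) (u :: s ++ x :: t).
Proof.
rewrite rcons_path => /andP[ps e] pt.
have := @opath_path _ u (s ++ x :: t).
by rewrite last_cat; apply; rewrite cat_path ps /= e.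
Qed.

Lemma nbr_clique_path u s : uniq s -> {in s, forall a, edge u a} ->
  {in s &, forall a b, a != b -> ore a b} -> path_ore u s.
Proof.
case: s => //= a s us eu cl; rewrite edge_ore ?eu ?mem_head //=.
exact: clique_path.
Qed.

(* The path from [u] through its neighbours in [H] to [v], followed by [s2] and
   the neighbours of [u] on [s1], is not longer than the cycle; this bounds the
   degree of [u]. *)
Lemma far_nore u v s1 s2 r z : theta u v s1 s2 r ->
  {in s1 & H, forall a z, ~~ edge a z} ->
  z \in H -> ~~ edge u z -> ~~ ore u z.
Proof.
move=> th free zH nuz; apply/negP=> /ore_degree/(_ nuz) hd.
have [y [s2' E2]] := theta_cons obs (theta_flip th).
have uy : edge u y by have := theta_flip th; rewrite E2 => /theta_head.
set K := enum [set w in H | edge u w].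
have KE w : (w \in K) = (w \in H) && edge u w by rewrite mem_enum in_set.
have uK : uniq K by rewrite enum_uniq.
have sK : size K = #|[set w in H | edge u w]| by rewrite cardE.
set Y := filter (edge u) s1.
have hK : size K + size Y <= size s1.
  have ev : edge (last u r) v.
    by have := theta_pathH th; rewrite rcons_path => /andP[].
  (* Cutting [r] at its last neighbour of [u] makes the rest disjoint from [K], so all of [K] can be
     visited before it. *)
  have [k [t [uk pk lk sk tK]]] : exists k t, [/\ edge u k, path edge k t,
      last k t = last u r, subseq (k :: t) r & ~~ has (edge u) t].
    have := theta_pathH th; have := theta_nil th; case: (r) => // z0 r' _.
    rewrite rcons_path /= => /andP[/andP[e0 p0] _].
    exact: path_suffix_last p0 e0.
  have kH : {subset k :: t <= H}.
    by move=> w /(mem_subseq sk)/(theta_H th).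
  have kK : k \in K by rewrite KE uk kH ?mem_head.
  set K' := rem k K.
  have pK : perm_eq (K' ++ [:: k]) K.
    by rewrite perm_catC; rewrite perm_sym; apply: perm_to_rem.
  have p1 : path_ore u (rcons K' k).
    rewrite -cats1; apply: nbr_clique_path.
    - by rewrite (perm_uniq pK).
    - by move=> a; rewrite (perm_mem pK) KE => /andP[].
    move=> a b; rewrite !(perm_mem pK) !KE => /andP[aH ua] /andP[bH ub].
    by apply: (outside_clique th); rewrite // inE (obs_disjoint obs).
  have p4 : path_ore y Y.
    have lsY a : a \in y :: Y -> (a \in y :: s1) && edge u a.
      rewrite !inE mem_filter => /predU1P[->|/andP[-> ->]]; last by rewrite orbT.
      by rewrite eqxx uy.
    apply: clique_path.
      rewrite /= filter_uniq; last first.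
        by have := theta_uniq th; rewrite /= cat_uniq => /and3P[_ _ /and3P[]].
      rewrite mem_filter andbT negb_and.
      have := theta_uniq th; rewrite E2 /= => /and3P[_ _].
      by rewrite uniq_catC /= mem_cat negb_or => /andP[/andP[_ ->]]; rewrite orbT.
    move=> a b /lsY/andP[aI ua] /lsY/andP[bI ub] ab.
    have th2 := th; rewrite E2 in th2.
    exact: (nbr_clique obs th2 free aI bI ua ub ab).
  have := rcons_path_rev (@edge_sym G) (theta_path2 th).
  rewrite rcons_path => /andP[p3 _].
  have p2 := opath_clique p1 (edge_path_ore pk).
  have evt : edge (last k t) v by rewrite lk.
  have lastv : last v (rev s2) = y by rewrite E2 rev_cons last_rcons.
  have p3' : path_ore v (rev s2 ++ Y).
    by rewrite cat_path edge_path_ore // lastv.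
  have := opath_extend p2 (s := v :: rev s2 ++ Y).
  rewrite /= edge_ore //= last_cat lastv => /(_ p3') p5.
  have lY : edge (last y Y) u.
    rewrite edge_sym; have := mem_last y Y; rewrite inE mem_filter.
    by case/predU1P => [->|/andP[]].
  have := obs_max obs p5 (edge_ore lY).
  have -> : uniq ((u :: K' ++ k :: t) ++ v :: rev s2 ++ Y).
    apply: (@perm_uniq_imp _ _ ((u :: v :: Y ++ s2) ++ (K' ++ [:: k]) ++ t)).
      by perm_by_count.
    rewrite cat_uniq; apply/and3P; split.
    - apply: subseq_uniq (theta_uniq th).
      by rewrite /= !eqxx cat_subseq ?filter_subseq.
    - rewrite -all_predC; apply/allP=> a; rewrite mem_cat (perm_mem pK) KE.
      move=> aH; have : a \notin C.
        apply: (obs_disjoint obs); case/orP: aH => [/andP[]//|at'].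
        by apply: kH; rewrite inE at' orbT.
      apply: contra; rewrite -(theta_C th) !inE !mem_cat mem_filter.
      by do ![case/orP] => [->|->|/andP[_ ->]|->]; rewrite ?orbT.
    - rewrite cat_uniq (perm_uniq pK) uK /=; apply/andP; split.
        apply/hasPn=> a at'; rewrite /= (perm_mem pK) KE negb_and.
        by rewrite (hasPn tK) ?orbT.
      by have /andP[] := subseq_uniq sk (theta_uniqH th).
  have := perm_size pK; rewrite (theta_card th) !size_cat /= !size_cat /= !size_cat size_rev.
  by move=> <- /(_ isT); clear; lia.
have hu := theta_degree u th; have hz := theta_degree z th.
have ho := theta_order th.
rewrite edge_irrefl in hu; rewrite [edge z u]edge_sym (negPf nuz) in hz.
have cz1 : count (edge z) s1 = 0.
  apply/eqP; rewrite -leqn0 leqNgt -has_count; apply/hasPn=> a aI.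
  by rewrite edge_sym free.
(* Each neighbour of [z] is charged to its successor, a nonneighbour of [u] by [nbr_after_attached];
   the last vertex [y] is no neighbour of [z], so no unit is lost. *)
have cs : count (edge z) (v :: rev s2) <= count (predC (edge u)) (rev s2).
  case: (first_consecutive [rel a b | edge z a && edge u b] (v :: rev s2)).
    move=> /= srt.
    have hf : path [rel a b | edge z a ==> ~~ edge u b] v (rev s2).
      by apply: sub_path srt => a b /=; rewrite negb_and implybE.
    have := count_followed hf; rewrite E2 rev_cons last_rcons.
    have -> : edge z y = false; last by rewrite addn0.
    have := theta_flip th; rewrite E2 => /(head_H obs)/(_ zH)/oreNedge.
    by rewrite edge_sym => /negPf.
  case=> l1 [a [b [l2 [E /andP[/= za ub] _]]]].
  by have := nbr_after_attached obs th zH E za; rewrite edge_ore.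
have cu : count (edge u) s2 + count (predC (edge u)) (rev s2) = size s2.
  by rewrite count_rev count_predC.
have HC : H \subset ~: C by apply/subsetP=> w /(obs_disjoint obs); rewrite inE.
have oz : #|[set w | (w \notin C) && edge z w]| < #|H|.
  rewrite (cardsD1 z H) zH add1n ltnS; apply: subset_leq_card.
  apply/subsetP=> w; rewrite in_setD1 in_set => /andP[wC zw].
  rewrite (obs_closed obs zH zw wC) andbT.
  by apply: contraTneq zw => ->; rewrite edge_irrefl.
have ou : #|[set w | (w \notin C) && edge u w]| <= size K + #|~: C :\: H|.
  rewrite sK (leq_trans _ (leq_card_setU _ _)) //; apply: subset_leq_card.
  apply/subsetP=> w; rewrite !inE => /andP[-> ->].
  by rewrite !andbT orbN.
have hD := cardsD (~: C) H; rewrite (setIidPr HC) in hD.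
have hHC := subset_leq_card HC.
rewrite /= count_rev in cs; rewrite (edge_sym z v) in hz cs.
have sY : size Y = count (edge u) s1 by rewrite size_filter.
have bv : edge u v <= 1 by case: edge.
move: hd hu hz ho cz1 cs cu oz ou hD hHC hK sY bv; clear.
lia.
Qed.

End RootNore.

(** * Neighbours of both roots on one side of the cycle *)

Section RootPair.
Variables (G : sgraph) (C H : {set G}).
Implicit Types (x y z u v w a b : G) (s l r t : seq G).
Hypothesis obs : obstruction C H.
Local Notation theta := (theta C H).
Local Notation path_ore := (path (@ore G)).

Lemma theta_uniq1 u v s1 s2 r : theta u v s1 s2 r -> uniq s1.
Proof. by move/theta_uniq; rewrite !cons_uniq cat_uniq => /and3P[_ _ /andP[]]. Qed.

Lemma rcons_head s x : exists y t, rcons s x = y :: t /\ last y t = x.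
Proof.
by case: s => [|y s]; [exists x, [::] | exists y, (rcons s x); rewrite last_rcons].
Qed.

(** Otherwise: [u], [w], back to the start of the side, over by [ends_ore], all of the other side,
    over again at [v], back to [w'], [v], and [r] backwards to [u]. *)
Lemma consecutive_nore u v s2 r l1 w w' l2 :
  theta u v (l1 ++ w :: w' :: l2) s2 r -> ore u w -> ore v w' -> False.
Proof.
move=> th ouw ovw.
have [y [s2' E2]] := theta_cons obs (theta_flip th); subst s2.
have [x [m1 [E1 lx]]] := rcons_head l1 w.
have oxy : ore x y.
  by move: th; rewrite -cat_rcons E1 => /(ends_ore obs).
have oyx : ore (last y s2') (last w' l2).
  have := theta_swap th; rewrite rev_cat !rev_last /=.
  by move=> /theta_flip/(ends_ore obs).
have := theta_path1 th; rewrite rcons_path -cat_rcons E1 cat_path /= lx.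
move=> /andP[/andP[/andP[ux p1] /andP[ww p2]] ev].
have := theta_path2 th; rewrite rcons_path /= => /andP[/andP[uy p3] e3].
have := rcons_path_rev (@edge_sym G) (theta_pathH th).
rewrite rcons_path => /andP[p4 e4].
have := opath_cat (opath1 u) ouw.
have := opath_path (path_revP (@ore_sym G) (edge_path_ore p1)).
rewrite last_rev_belast lx => q1 /(_ _ _ q1) q2.
have q3 := opath_cat q2 oxy (opath_path (edge_path_ore p3)).
have q4 := opath_cat q3 oyx
  (opath_path (path_revP (@ore_sym G) (edge_path_ore p2))).
rewrite last_rev_belast in q4.
have p5 : path_ore w' (v :: rev r).
  by rewrite /= ore_sym ovw edge_path_ore.
have q5 := opath_extend q4 p5.
apply: (no_longer obs th q5 _ _ (theta_uniqH th) _ (theta_nil th)).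
- exact: edge_ore.
- have -> : l1 ++ [:: w, w' & l2] = (x :: m1) ++ w' :: l2.
    by rewrite -E1 cat_rcons.
  rewrite -(rev_last w').
  have -> : w :: rev (belast x m1) = rev (x :: m1) by rewrite rev_last lx.
  by perm_by_count.
- by move=> z /(theta_H th)/(obs_disjoint obs).
Qed.

Lemma consecutive_nore_rev u v s2 r l1 w w' l2 :
  theta u v (l1 ++ w :: w' :: l2) s2 r -> ore v w -> ore u w' -> False.
Proof.
move=> th ovw ouw.
have [y [s2' E2]] := theta_cons obs (theta_flip th); subst s2.
have [x [m1 [E1 lx]]] := rcons_head l1 w.
have oxy : ore x y.
  by move: th; rewrite -cat_rcons E1 => /(ends_ore obs).
have oyx : ore (last w' l2) (last y s2').
  have := theta_swap th; rewrite rev_cat !rev_last /=.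
  exact: ends_ore.
have := theta_path1 th; rewrite rcons_path -cat_rcons E1 cat_path /= lx.
move=> /andP[/andP[/andP[ux p1] /andP[ww p2]] ev].
have := theta_path2 th; rewrite rcons_path /= => /andP[/andP[uy p3] e3].
have := rcons_path_rev (@edge_sym G) (theta_pathH th).
rewrite rcons_path => /andP[p4 e4].
have q1 := opath_cat (opath1 u) ouw (opath_path (edge_path_ore p2)).
have q2 := opath_cat q1 oyx
  (opath_path (path_revP (@ore_sym G) (edge_path_ore p3))).
rewrite last_rev_belast ore_sym in q2 oxy.
have q3 := opath_cat q2 oxy (opath_path (edge_path_ore p1)).
rewrite lx in q3.
have p5 : path_ore w (v :: rev r).
  by rewrite /= ore_sym ovw edge_path_ore.
have q4' := opath_extend q3 p5.
apply: (no_longer obs th q4' _ _ (theta_uniqH th) _ (theta_nil th)).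
- exact: edge_ore.
- have -> : l1 ++ [:: w, w' & l2] = (x :: m1) ++ w' :: l2.
    by rewrite -E1 cat_rcons.
  by rewrite -(rev_last y); perm_by_count.
- by move=> z /(theta_H th)/(obs_disjoint obs).
Qed.

(** By the previous two lemmas [u] is unrelated to the cycle neighbours [ym], [yp] of a common
    neighbour [y], so the claw at [y] relates [ym] and [yp]. Then [y] is cut out of [s1] and visited
    right after [v], from where [nbr_clique] leads to the start of [s1]. *)
Lemma no_common_nbr u v s1 s2 r : theta u v s1 s2 r ->
  {in s1 & H, forall a z, ~~ edge a z} ->
  {in s1, forall y, edge u y -> edge v y -> False}.
Proof.
move=> th free y ys uy vy.
move: th free; case/path.splitPr: ys => l1 l2 th free.
have [m [ym E1]] : exists m ym, l1 = rcons m ym.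
  case/lastP: l1 th {free} => [|m ym] th; last by exists m, ym.
  have := theta_swap th; rewrite /= rev_cons.
  by move=> /theta_flip/(last_other_nore obs); rewrite edge_ore.
have [yp [n E2]] : exists yp n, l2 = yp :: n.
  case: l2 th {free} => [|yp n] th; last by exists yp, n.
  move: th; rewrite cats1 => /theta_flip/(last_other_nore obs).
  by rewrite edge_ore.
subst l1 l2.
have [x [m1 [Em lx]]] := rcons_head m ym.
have th2 : theta u v (m ++ ym :: y :: yp :: n) s2 r by rewrite -cat_rcons.
have th3 : theta u v (rcons m ym ++ y :: yp :: n) s2 r := th.
have nm : ~~ ore u ym.
  by apply/negP=> o; apply: (consecutive_nore th2 o); apply: edge_ore.
have np : ~~ ore u yp.
  by apply/negP=> o; apply: (consecutive_nore_rev th3 _ o); apply: edge_ore.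
have := theta_path1 th2; rewrite -cat_rcons Em /= rcons_cat cat_path /= lx.
case/and5P=> ux p1 my yyp p2.
have us : uniq ((x :: m1) ++ y :: yp :: n).
  by have := theta_uniq1 th2; rewrite -cat_rcons Em.
have ymI : ym \in x :: m1 by rewrite -lx mem_last.
have d1 : ym != yp.
  apply: contraTneq us => E; rewrite -E in ymI *.
  by rewrite cat_uniq /= ymI orbT andbF.
have d2 c : c \in x :: m1 ++ y :: yp :: n -> u != c.
  rewrite -cat_cons -Em cat_rcons => cI.
  apply: contraTneq (theta_uniq th2) => ->.
  by rewrite cons_uniq inE mem_cat cI orbT.
have omp : ore ym yp.
  have := claw_ore (obs_claw obs) (x := u) (y := ym) (z := yp) (c := y).
  rewrite edge_sym uy edge_sym my yyp.
  move=> /(_ isT isT isT); rewrite (negPf nm) (negPf np) d1 /=.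
  apply=> //; first by apply: d2; rewrite -cat_cons mem_cat ymI.
  by apply: d2; rewrite -cat_cons mem_cat !inE eqxx !orbT.
have [x2 [s2' E3]] := theta_cons obs (theta_flip th); subst s2.
have oyx : ore y x.
  apply: (nbr_clique obs th3 free) => //.
  - by rewrite inE mem_cat mem_head !orbT.
  - by rewrite Em /= !inE eqxx orbT.
  by apply: contraTneq us => ->; rewrite /= mem_cat mem_head orbT.
have [n' [xl El]] : exists n' xl, yp :: n = rcons n' xl.
  by exists (belast yp n), (last yp n); apply: lastI.
have [s2l [x2l E2l]] : exists s x, x2 :: s2' = rcons s x.
  by exists (belast x2 s2'), (last x2 s2'); apply: lastI.
have oxl : ore xl x2l.
  have := theta_swap th3; rewrite -cat_rcons El E2l rev_cat !rev_rcons.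
  exact: ends_ore.
have := rcons_path_rev (@edge_sym G) (theta_path2 th3).
rewrite E2l rev_rcons rcons_path => /andP[/andP[_ p3] e3].
have := theta_pathH th; rewrite rcons_path => /andP[p4 e4].
have p5 : path_ore u (r ++ v :: y :: x :: m1).
  rewrite cat_path (edge_path_ore p4) /= (edge_ore e4) (edge_ore vy) oyx.
  exact: edge_path_ore.
have q1 := opath_path p5.
rewrite last_cat /= lx in q1.
have p2' : path edge yp n by move: p2; rewrite rcons_path => /andP[].
have q2 := opath_cat q1 omp (opath_path (edge_path_ore p2')).
have ln : last yp n = xl by rewrite -[LHS]/(last yp (yp :: n)) El last_rcons.
rewrite ln in q2.
have q3 := opath_cat q2 oxl (opath_path (edge_path_ore p3)).
apply: (no_longer obs th q3 _ _ (theta_uniqH th) _ (theta_nil th)).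
- exact: edge_ore.
- by rewrite E2l Em; perm_by_count.
- by move=> z /(theta_H th)/(obs_disjoint obs).
Qed.

End RootPair.

(** * Two nonadjacent roots with a common neighbour in the component *)

Section NearRoot.
Variables (G : sgraph) (C H : {set G}).
Implicit Types (x y z u v w a b : G) (s l r t : seq G).
Hypothesis obs : obstruction C H.
Local Notation theta := (theta C H).
Local Notation path_ore := (path (@ore G)).

Lemma nbr_filter_path u v s1 y s2 r : theta u v s1 (y :: s2) r ->
  {in s1 & H, forall a z, ~~ edge a z} ->
  path_ore y (filter (edge u) s1) /\ edge (last y (filter (edge u) s1)) u.
Proof.
move=> th free; set Y := filter _ _.
have uy := theta_head (theta_flip th).
have sub a : a \in y :: Y -> (a \in y :: s1) && edge u a.
  rewrite !inE mem_filter => /predU1P[->|/andP[-> ->]]; last by rewrite orbT.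
  by rewrite eqxx uy.
split; last by have /andP[_] := sub _ (mem_last y Y); rewrite edge_sym.
apply: clique_path.
  rewrite /= filter_uniq ?(theta_uniq1 th) // andbT mem_filter uy.
  have := theta_uniq th; rewrite /= => /and3P[_ _].
  by rewrite uniq_catC /= mem_cat negb_or => /andP[/andP[]].
move=> a b /sub/andP[aI ua] /sub/andP[bI ub].
exact: (nbr_clique obs th free).
Qed.

Lemma uniq_cat_sub u v s s' t : uniq (u :: v :: s ++ t) -> uniq s' ->
  {subset s' <= s} -> uniq (u :: v :: s' ++ t).
Proof.
rewrite /= !inE !mem_cat !cat_uniq !negb_or.
move=> /and3P[/andP[-> /andP[us ->]] /andP[vs ->] /and3P[_ st ->]] -> sub.
rewrite !andbT /= (contra (sub u) us) (contra (sub v) vs) /=.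
apply: contra st => /hasP[x xt xs]; apply/hasP; exists x => //.
exact: sub.
Qed.

(* Same cycle as for [far_nore], with the neighbours of [v] on [s1] added. *)
Lemma near_nore u v s1 s2 r z : theta u v s1 s2 r ->
  {in s1 & H, forall a z, ~~ edge a z} ->
  z \in H -> edge u z -> edge v z -> ~~ edge u v -> ~~ ore u v.
Proof.
move=> th free zH uz vz nuv; apply/negP=> /ore_degree/(_ nuv) hd.
have thr := theta_swap th.
have free' : {in rev s1 & H, forall a w, ~~ edge a w}.
  by move=> a w; rewrite mem_rev; apply: free.
have [y [s2' Ey]] := theta_cons obs (theta_flip th).
have [x [s2'' Ex]] := theta_cons obs (theta_flip thr).
set K0 := enum [set w | (w \notin C) && edge u w].
set K1 := enum [set w | (w \notin C) && edge v w].
have K0E w : (w \in K0) = (w \notin C) && edge u w by rewrite mem_enum in_set.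
have K1E w : (w \in K1) = (w \notin C) && edge v w by rewrite mem_enum in_set.
set K1' := filter (predC (mem K0)) K1.
have K1'E w : (w \in K1') = (w \notin K0) && (w \in K1).
  by rewrite mem_filter.
have zK0 : z \in K0 by rewrite K0E (obs_disjoint obs zH) uz.
set K0' := rem z K0.
have pK : perm_eq (K0' ++ [:: z]) K0.
  by rewrite perm_catC perm_sym; apply: perm_to_rem.
have uK : uniq (K0 ++ K1').
  rewrite cat_uniq enum_uniq filter_uniq ?enum_uniq //= andbT.
  by apply/hasPn=> w; rewrite mem_filter => /andP[].
set Y0 := filter (edge u) s1; set Y1 := filter (edge v) (rev s1).
have hK : size (K0 ++ K1') + (size Y0 + size Y1) <= size s1.
  have p1 : path_ore u (rcons K0' z).
    rewrite -cats1; apply: nbr_clique_path.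
    - by rewrite (perm_uniq pK) enum_uniq.
    - by move=> a; rewrite (perm_mem pK) K0E => /andP[].
    move=> a b; rewrite !(perm_mem pK) !K0E => /andP[aH ua] /andP[bH ub].
    exact: (outside_clique obs th).
  have zK1 a : a \in z :: K1' -> (a \notin C) && edge v a.
    rewrite inE K1'E K1E => /predU1P[->|/andP[_ ->] //].
    by rewrite (obs_disjoint obs zH).
  have p2 : path_ore z K1'.
    apply: clique_path.
      by rewrite /= mem_filter /= zK0 filter_uniq ?enum_uniq.
    move=> a b /zK1/andP[aC va] /zK1/andP[bC vb].
    exact: (outside_clique obs thr).
  have evK : edge (last z K1') v.
    by have /andP[_] := zK1 _ (mem_last z K1'); rewrite edge_sym.
  have [p3 e3] : path_ore y Y0 /\ edge (last y Y0) u.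
    by apply: (nbr_filter_path (v := v) (s2 := s2') (r := r)) free; rewrite -Ey.
  have [p4 e4] : path_ore x Y1 /\ edge (last x Y1) v.
    by apply: (nbr_filter_path (v := u) (s2 := s2'') (r := rev r)) free';
      rewrite -Ex.
  have := rcons_path_rev (@edge_sym G) (theta_path2 th).
  rewrite rcons_path Ex => /andP[/= /andP[_ p5] _].
  have l5 : last x s2'' = y.
    rewrite -[LHS]/(last x (x :: s2'')) -Ex Ey rev_cons last_rcons.
    by [].
  have p6 : path_ore x (s2'' ++ Y0) by rewrite cat_path edge_path_ore // l5.
  have pv : path_ore (last z K1') [:: v] by rewrite /= edge_ore.
  have q2 := opath_extend (opath_clique p1 p2) pv.
  have oev : ore v (last x Y1) by rewrite ore_sym edge_ore.
  have q3 := opath_cat q2 oev (opath_sym (opath_path p4)).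
  have q4 := opath_extend q3 p6; rewrite last_cat l5 in q4.
  have ul : uniq
      ((((u :: K0' ++ z :: K1') ++ [:: v]) ++ x :: Y1) ++ s2'' ++ Y0).
    have ps2 : perm_eq (x :: s2'') s2 by rewrite -Ex perm_rev.
    apply: (@perm_uniq_imp _ _ ((u :: v :: (Y0 ++ Y1) ++ (x :: s2'')) ++
      (K0' ++ [:: z]) ++ K1')); first by perm_by_count.
    rewrite cat_uniq; apply/and3P; split.
    - apply: (uniq_cat_sub (s := s1)).
      + by apply: (perm_uniq_imp _ (theta_uniq th)); rewrite /= !perm_cons perm_cat2l.
      + rewrite cat_uniq !filter_uniq ?rev_uniq ?(theta_uniq1 th) //= andbT.
        apply/hasPn=> a; rewrite !mem_filter mem_rev => /andP[va as1].
        apply/negP=> /= /andP[ua _].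
        exact: (no_common_nbr obs th free as1 ua va).
      + by move=> a; rewrite mem_cat !mem_filter mem_rev => /orP[] /andP[].
    - apply/hasPn=> a; rewrite mem_cat (perm_mem pK) K1'E K1E K0E.
      move=> aI; have aC : a \notin C.
        by case/orP: aI => [/andP[]|/andP[_ /andP[]]].
      apply: contra aC; rewrite -(theta_C th) /= !inE !mem_cat -(mem_rev s2) Ex.
      rewrite !mem_filter mem_rev !inE -!orbA.
      by case/or4P => [->|->|/andP[_ ->]|/or3P[/andP[_ ->]|->|->]];
        rewrite ?orbT.
    by apply: (perm_uniq_imp _ uK); rewrite perm_cat2r.
  have := obs_max obs q4 (edge_ore e3) ul.
  have := perm_size pK; rewrite (theta_card th).
  have : size s2 = (size s2'').+1 by rewrite -size_rev Ex.
  rewrite ?size_cat /= ?size_cat /= ?size_cat /= ?size_cat.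
  by move=> -> <-; clear; lia.
have hu := theta_degree u th; have hv := theta_degree v th.
have ho := theta_order th.
rewrite !edge_irrefl [edge v u]edge_sym (negPf nuv) !add0n in hu hv.
have sY0 : size Y0 = count (edge u) s1 by rewrite size_filter.
have sY1 : size Y1 = count (edge v) s1 by rewrite size_filter count_rev.
have sK0 : size K0 = #|[set w | (w \notin C) && edge u w]| by rewrite cardE.
(* The outside neighbourhoods of [u] and [v] may overlap, so their sizes are bounded by twice the
   union: one copy is paid for by [hK], the other by the complement of [C]. *)
have sK1 : #|[set w | (w \notin C) && edge v w]| <= size (K0 ++ K1').
  rewrite cardE -/K1; apply: uniq_leq_size; first exact: enum_uniq.
  by move=> w wK; rewrite mem_cat K1'E wK andbT orbN.
have sK : size (K0 ++ K1') <= #|~: C|.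
  rewrite -(card_uniqP uK); apply: subset_leq_card; apply/subsetP=> w.
  rewrite mem_cat K1'E K1E K0E inE.
  by case/orP=> [/andP[]|/andP[_ /andP[]]].
have cs : (count (edge u) s2 + count (edge v) s2).+1 <= size s2.
  have nvy : edge v y = false.
    have := theta_swap th; rewrite Ey rev_cons.
    by move=> /(last_other_nore obs)/oreNedge/negPf.
  have nux : edge u (last y s2') = false.
    have := th; rewrite Ey lastI.
    by move=> /(last_other_nore obs)/oreNedge/negPf.
  case: (first_consecutive [rel a b | edge u a && edge v b] s2).
    rewrite Ey /= => srt.
    have hf : path [rel a b | edge u a ==> ~~ edge v b] y s2'.
      by apply: sub_path srt => a b /=; rewrite negb_and implybE.
    have := count_followed hf; have := count_predC (edge v) s2'.
    by rewrite nvy nux /=; clear; lia.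
  case=> l1 [a [b [l2 [E /andP[/= ua vb] _]]]].
  case: (consecutive_nore obs (u := u) (v := v) (s2 := s1) (r := r)
    (l1 := l1) (w := a) (w' := b) (l2 := l2)); rewrite ?edge_ore //.
  by rewrite -E; apply: theta_flip.
move: hd hu hv ho sY0 sY1 sK0 sK1 sK cs hK; rewrite size_cat; clear; lia.
Qed.

End NearRoot.

(** * Chains of cliques around a root *)

Section Chain.
Variable G : sgraph.
Implicit Types (x y z u v w a b c t : G) (s l r T L : seq G) (lev : G -> nat).
Local Notation path_ore := (path (@ore G)).

(* Vertices on distant levels may form an [ore]-pair, but not an edge. *)
Record chain u T lev m : Prop := Chain {
  chain_root : lev u = 0;
  chain_levels : {in T, forall a, 0 < lev a <= m.+1};
  chain_ore : {in u :: T &, forall a b, a != b ->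
    lev a <= (lev b).+1 -> lev b <= (lev a).+1 -> ore a b};
  chain_nonedge : {in u :: T &, forall a b,
    (lev a).+1 < lev b -> ~~ edge a b} }.

(* [L] is a class of vertices whose [ore]-pairs are edges and which meets all
   levels up to [m]; the path [c], lower vertices of [L], [u], [z], [z'] serves
   as the long arm of the wounded subgraphs.  The vertex [f] is put one level
   above its lowest neighbour. *)
Section Extend.
Variables (u f z z' : G) (T L : seq G) (lev : G -> nat) (m : nat).
Hypothesis ch : chain u T lev m.
Hypothesis claw_heavy : H_heavy claw G.
Hypothesis wounded_heavy : H_heavy wounded G.
Hypothesis LT : {subset L <= T}.
Hypothesis L_levels : forall j, 0 < j <= m -> exists2 c, c \in L & lev c = j.
Hypothesis L_light : {in u :: L & u :: f :: T, forall c a, ore c a -> edge c a}.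
Hypothesis fT : f \notin u :: T.
Hypothesis uz : edge u z.
Hypothesis fz : {in f :: T, forall a, ~~ ore a z}.

Definition add_level i a := if a == f then i.+1 else lev a.

Let sub1 : {subset u :: T <= u :: f :: T}.
Proof. by move=> a; rewrite !inE => /orP[->|->]; rewrite ?orbT. Qed.

Let subL : {subset u :: L <= u :: T}.
Proof. by move=> a; rewrite !inE => /predU1P[->|/LT->]; rewrite ?eqxx ?orbT. Qed.

Let fI : f \in u :: f :: T. Proof. by rewrite !inE eqxx orbT. Qed.

Let nore_L c a : c \in u :: L -> a \in u :: f :: T -> ~~ edge c a -> ~~ ore c a.
Proof. by move=> cL aT; apply: contra; apply: L_light. Qed.

Let edge_L c a : c \in u :: L -> a \in u :: T -> c != a ->
  lev a <= (lev c).+1 -> lev c <= (lev a).+1 -> edge c a.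
Proof.
move=> cL aT ca h1 h2; apply: L_light => //; first exact: sub1.
by apply: (chain_ore ch) => //; apply: subL.
Qed.

Let far_L c a : c \in u :: L -> a \in u :: T ->
  (lev c).+1 < lev a \/ (lev a).+1 < lev c -> ~~ ore c a.
Proof.
move=> cL aT h; apply: nore_L => //; first exact: sub1.
have cT := subL cL.
by case: h => h; [|rewrite edge_sym]; apply: (chain_nonedge ch).
Qed.

Let rep j : j <= m -> exists2 c, c \in u :: L & lev c = j.
Proof.
case: j => [|j] hj; first by exists u; rewrite ?mem_head // (chain_root ch).
by have [c cL <-] := L_levels (j := j.+1) hj; exists c; rewrite // inE cL orbT.
Qed.

Let lev0 a : a \in u :: T -> lev a = 0 -> a = u.
Proof. by rewrite inE => /predU1P[//|/(chain_levels ch)]; case: (lev a). Qed.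

Let neq_lev a b : lev a <> lev b -> a != b.
Proof. by move=> h; apply/eqP => E; apply: h; rewrite E. Qed.

Let adj_L c a : c \in u :: L -> a \in u :: T ->
  lev a = (lev c).+1 \/ lev c = (lev a).+1 -> edge c a.
Proof.
move=> cL aT h; apply: edge_L => //; last 2 first.
- by case: h => ->; clear; lia.
- by case: h => ->; clear; lia.
by apply: neq_lev; case: h => ->; clear; lia.
Qed.

(** Each level is compared with [f] by one forbidden configuration: level [i] by wounded graphs
    whose triangle uses levels [i-1] and [i] and whose pendant vertex is [f]; level [i+1] by a claw
    at level [i]; higher levels by wounded graphs whose triangle contains [f] and whose pendant
    vertex is the higher one. For [i = 0] the only vertex of the level is [u]. *)
Lemma chain_extend (i : nat) :
  edge z z' -> ~~ ore u z' -> {in f :: T, forall a, ~~ ore a z'} ->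
  (exists2 t, t \in u :: T & edge f t && (lev t == i)) -> i <= m ->
  {in u :: T, forall t, edge f t -> i <= lev t} ->
  chain u (f :: T) (add_level i) m.
Proof.
move=> zz uz' fz' [t0 t0T /andP[ft0 /eqP lt0]] im imin.
have uT : u \in u :: T by rewrite mem_head.
have uL : u \in u :: L by rewrite mem_head.
have TT a : a \in u :: T -> 0 < lev a -> a \in f :: T.
  rewrite !inE => /predU1P[->|->]; last by rewrite orbT.
  by rewrite (chain_root ch).
have ff : f \in f :: T by rewrite mem_head.
have flow c : c \in u :: L -> lev c < i -> ~~ ore f c.
  move=> cL lc; rewrite ore_sym; apply: nore_L => //; rewrite edge_sym.
  by apply/negP=> /(imin _ (subL cL)); rewrite leqNgt lc.
(* The long arm at [c]: two levels down inside [L], continued by [z] and [z'] when the levels run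
   out. *)
have tail c : c \in u :: L -> lev c <= i -> exists d1 d2,
    [/\ edge c d1, edge d1 d2, ~~ ore c d2,
      {in u :: T, forall a, lev c < lev a -> ~~ ore a d1 && ~~ ore a d2}
      & ~~ ore f d1 && ~~ ore f d2].
  move=> cL ci; have cT := subL cL.
  case E: (lev c) => [|[|j]].
  - exists z, z'; rewrite (lev0 cT E); split => //; last by rewrite fz ?fz'.
    by move=> a aT la; rewrite fz ?fz' //; apply: TT.
  - exists u, z; have lcpos : 0 < lev c by rewrite E.
    split => //.
    + by apply: adj_L => //; right; rewrite E (chain_root ch).
    + by apply: fz; apply: TT.
    + move=> a aT la; rewrite ore_sym far_L ?(chain_root ch) //=; last by left.
      by apply: fz; apply: TT => //; apply: leq_trans la.
    + by rewrite fz // andbT; apply: flow; rewrite // (chain_root ch) -ltnS -E.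
  - have [d1 d1L l1] : exists2 c, c \in u :: L & lev c = j.+1.
      by apply: rep; move: ci im; rewrite E; clear; lia.
    have [d2 d2L l2] : exists2 c, c \in u :: L & lev c = j.
      by apply: rep; move: ci im; rewrite E; clear; lia.
    have d1T := subL d1L; have d2T := subL d2L.
    exists d1, d2; split.
    + by apply: adj_L => //; right; rewrite l1 E.
    + by apply: adj_L => //; right; rewrite l1 l2.
    + by apply: far_L => //; right; rewrite l2 E.
    + move=> a aT la; rewrite ![ore a _]ore_sym !far_L ?l1 ?l2 //; left.
      * by apply: leq_trans la; rewrite ltnW.
      * by apply: leq_trans la.
    + by rewrite !flow ?l1 ?l2 //; move: ci; rewrite E; clear; lia.
have fc c : c \in u :: L -> lev c = i -> edge f c.
  move=> cL lc; have cT := subL cL.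
  case: (eqVneq t0 c) => [<-//|t0c].
  have ipos : 0 < i.
    rewrite lt0n; apply: contraNneq t0c => i0.
    by rewrite (lev0 t0T) ?lt0 // (lev0 cT) ?lc.
  have [d dL ld] : exists2 c, c \in u :: L & lev c = i.-1.
    by apply: rep; move: im; clear; lia.
  have dT := subL dL.
  have [d1 [d2 [e1 e2 n1 nT nf]]] := tail d dL ltac:(rewrite ld; clear; lia).
  apply/negPn/negP=> nfc.
  have /andP[n2 n3] := nT t0 t0T ltac:(rewrite ld lt0; move: ipos; clear; lia).
  have /andP[n4 n5] := nT c cT ltac:(rewrite ld lc; move: ipos; clear; lia).
  have /andP[n6 n7] := nf.
  apply: (wounded_ore wounded_heavy (a := t0) (b := d) (c := c) (a' := f)
    (b' := d1) (b'' := d2)) => //.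
  - by rewrite edge_sym; apply: adj_L => //; left; rewrite ld lt0 prednK.
  - by rewrite edge_sym; apply: edge_L; rewrite ?lc ?lt0 // eq_sym.
  - by apply: adj_L => //; left; rewrite ld lc prednK.
  - by rewrite edge_sym.
  - by rewrite ore_sym; apply: flow; rewrite // ld; move: ipos; clear; lia.
  - by apply: nore_L; rewrite // edge_sym.
(* Now [c] in [L] is joined to [f] by a genuine edge and can carry the pendant [f], whichever vertex
   [t] of the level is tested. *)
have ft1 t : t \in u :: T -> lev t = i -> ore f t.
  move=> tT lt.
  have [c cL lc] := rep im; have cT := subL cL.
  case: (eqVneq t c) => [->|tc]; first by rewrite edge_ore ?fc.
  have ipos : 0 < i.
    rewrite lt0n; apply: contraNneq tc => i0.
    by rewrite (lev0 tT) ?lt // (lev0 cT) ?lc.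
  have [d dL ld] : exists2 c, c \in u :: L & lev c = i.-1.
    by apply: rep; move: im; clear; lia.
  have dT := subL dL.
  have [d1 [d2 [e1 e2 n1 nT nf]]] := tail d dL ltac:(rewrite ld; clear; lia).
  apply/negPn/negP=> nft.
  have /andP[n2 n3] := nT t tT ltac:(rewrite ld lt; move: ipos; clear; lia).
  have /andP[n4 n5] := nT c cT ltac:(rewrite ld lc; move: ipos; clear; lia).
  have /andP[n6 n7] := nf.
  apply: (wounded_ore wounded_heavy (a := c) (b := d) (c := t) (a' := f)
    (b' := d1) (b'' := d2)) => //.
  - by rewrite edge_sym; apply: adj_L => //; left; rewrite ld lc prednK.
  - by apply: edge_L; rewrite ?lc ?lt // eq_sym.
  - by apply: adj_L => //; left; rewrite ld lt prednK.
  - by rewrite edge_sym fc.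
  - by rewrite ore_sym; apply: flow; rewrite // ld; move: ipos; clear; lia.
  - by rewrite ore_sym.
have [c cL lc] := rep im; have cT := subL cL.
have fc0 := fc c cL lc; have cf : edge c f by rewrite edge_sym.
have [d1 [d2 [e1 e2 n1 nT /andP[nf1 nf2]]]] := tail c cL ltac:(by rewrite lc).
have ft2 t : t \in u :: T -> lev t = i.+1 -> ore f t.
  move=> tT lt.
  have /andP[n2 n3] := nT t tT ltac:(by rewrite lc lt).
  have ct : edge c t.
    by apply: adj_L => //; left; rewrite lc lt.
  have := claw_ore claw_heavy e1 cf ct.
  rewrite ![ore d1 _]ore_sym (negPf nf1) (negPf n2) /=; apply.
  - by apply: contraNneq nf2 => <-; apply: edge_ore.
  - by apply: contraNneq n3 => <-; apply: edge_ore.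
  - by apply: contraNneq fT => ->.
have c'P : i < m -> exists c', [/\ c' \in u :: L, lev c' = i.+1, edge f c' & edge c c'].
  move=> /rep[c' c'L lc']; exists c'; have c'T := subL c'L; split => //.
    rewrite edge_sym; apply: L_light => //; rewrite ore_sym; exact: ft2.
  by apply: adj_L => //; left; rewrite lc lc'.
have ft3 t : t \in u :: T -> lev t = i.+2 -> ore f t.
  move=> tT lt.
  have [|c' [c'L lc' fc' cc']] := c'P.
    have := tT; rewrite inE => /predU1P[E|/(chain_levels ch)].
      by move: lt; rewrite E (chain_root ch).
    by rewrite lt; clear; lia.
  have c'T := subL c'L.
  apply/negPn/negP=> nft.
  have /andP[n2 n3] := nT t tT ltac:(rewrite lc lt; clear; lia).
  have /andP[n4 n5] := nT c' c'T ltac:(by rewrite lc lc').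
  apply: (wounded_ore wounded_heavy (a := c') (b := c) (c := f) (a' := t)
    (b' := d1) (b'' := d2)) => //; try by rewrite edge_sym.
  - by apply: adj_L => //; left; rewrite lc' lt.
  - by apply: far_L => //; left; rewrite lc lt.
have ft4 t : t \in u :: T -> i.+2 < lev t -> ~~ edge f t.
  move=> tT lt; apply/negP=> ft.
  have [|c' [c'L lc' fc' cc']] := c'P.
    have := tT; rewrite inE => /predU1P[E|/(chain_levels ch)].
      by move: lt; rewrite E (chain_root ch).
    by move: lt; clear; lia.
  have c'T := subL c'L.
  have /andP[n2 n3] := nT t tT ltac:(rewrite lc; move: lt; clear; lia).
  have /andP[n4 n5] := nT c' c'T ltac:(by rewrite lc lc').
  apply: (wounded_ore wounded_heavy (a := f) (b := c) (c := c') (a' := t)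
    (b' := d1) (b'' := d2)) => //.
  - by apply: far_L => //; left; rewrite lc; move: lt; clear; lia.
  - by apply: far_L => //; left; rewrite lc'.
have lf a : a \in u :: T -> add_level i a = lev a.
  by move=> aT; rewrite /add_level; case: eqP aT fT => // -> ->.
have lff : add_level i f = i.+1 by rewrite /add_level eqxx.
have memF a : a \in u :: f :: T -> a = f \/ a \in u :: T.
  by rewrite !inE => /or3P[|/eqP|] ->; rewrite ?orbT; auto.
have oref t : t \in u :: T -> i <= lev t -> lev t <= i.+2 -> ore f t.
  rewrite leq_eqVlt => tT /predU1P[/esym/ft1|]; first by auto.
  rewrite leq_eqVlt => /predU1P[/esym/ft2|h1 h2]; first by auto.
  by apply: ft3 => //; apply/eqP; rewrite eqn_leq h2.
split.
- by rewrite lf ?(chain_root ch).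
- move=> a; rewrite inE => /predU1P[->|aT]; first by rewrite lff; apply: im.
  by rewrite lf ?inE ?aT ?orbT //; apply: (chain_levels ch).
- move=> a b /memF[->|aT] /memF[->|bT]; rewrite ?eqxx // ?lff ?lf //.
  + by move=> _ h1 h2; apply: oref.
  + by move=> _ h1 h2; rewrite ore_sym; apply: oref.
  + exact: (chain_ore ch).
- move=> a b /memF[->|aT] /memF[->|bT]; rewrite ?lff ?lf ?edge_irrefl //.
  + exact: ft4.
  + move=> h; rewrite edge_sym; apply/negP=> /(imin _ aT).
    by move: h; clear; lia.
  + exact: (chain_nonedge ch).
Qed.

(** With a single level, the claw at [u] with leaf [z] relates [f] to every vertex of that level. *)
Lemma chain_extend_star : z \notin f :: T -> {in T, forall a, lev a = 1} -> edge u f ->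
  chain u (f :: T) (add_level 0) m.
Proof.
move=> zN lev1 uf.
have lf a : a \in u :: T -> add_level 0 a = lev a.
  by move=> aT; rewrite /add_level; case: eqP aT fT => // -> ->.
have lff : add_level 0 f = 1 by rewrite /add_level eqxx.
have memF a : a \in u :: f :: T -> a = f \/ a \in u :: T.
  by rewrite !inE => /or3P[|/eqP|] ->; rewrite ?orbT; auto.
have oref t : t \in u :: T -> ore f t.
  rewrite inE => /predU1P[->|tT]; first by rewrite edge_ore // edge_sym.
  have tI : t \in u :: T by rewrite inE tT orbT.
  have ut : edge u t.
    by apply: adj_L; rewrite ?mem_head //; left; rewrite lev1 ?(chain_root ch).
  have zC a : a \in f :: T -> (z != a) && ~~ ore z a.
    move=> aI; rewrite ore_sym fz // andbT.
    by apply: contraNneq zN => ->.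
  have /andP[zf nzf] := zC f (mem_head f T).
  have /andP[zt nzt] : (z != t) && ~~ ore z t by apply: zC; rewrite inE tT orbT.
  have := claw_ore claw_heavy uz uf ut zf zt.
  rewrite (negPf nzf) (negPf nzt) /=; apply.
  by apply: contraNneq fT => ->.
split.
- by rewrite lf ?mem_head ?(chain_root ch).
- move=> a; rewrite inE => /predU1P[->|aT]; first by rewrite lff.
  by rewrite lf ?inE ?aT ?orbT //; apply: (chain_levels ch).
- move=> a b /memF[->|aT] /memF[->|bT]; rewrite ?eqxx // ?lff ?lf //.
  + by move=> _ _ _; apply: oref.
  + by move=> _ _ _; rewrite ore_sym; apply: oref.
  + exact: (chain_ore ch).
- have le1 a : a \in u :: T -> lev a <= 1.
    by rewrite inE => /predU1P[->|/lev1->//]; rewrite (chain_root ch).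
  move=> a b /memF[->|aT] /memF[->|bT]; rewrite ?lff ?lf ?edge_irrefl //.
  + by move: (le1 b bT); clear; lia.
  + by move: (le1 b bT); clear; lia.
Qed.

End Extend.
End Chain.

(** * Spanning paths of a chain *)

Section ChainPaths.
Variables (G : sgraph) (u : G) (T : seq G) (lev : G -> nat) (m : nat).
Implicit Types (x y a b : G) (l : seq G) (j : nat).
Hypothesis ch : chain u T lev m.
Hypothesis uniqT : uniq (u :: T).
Hypothesis two : forall j, 0 < j <= m ->
  exists a b, [/\ a \in T, b \in T, a != b, lev a = j & lev b = j].

Let up j := [seq a <- T | j < lev a].
Let level j := [seq a <- T | lev a == j].

Let up_split j : perm_eq (up j) (level j.+1 ++ up j.+1).
Proof.
apply/permP=> P; rewrite count_cat !count_filter.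
by elim: T => //= a s ->; case: (P a) => //=; case: ltngtP; clear; lia.
Qed.

Let uT : uniq T. Proof. by case/andP: uniqT. Qed.

Let up_uniq j : uniq (up j). Proof. exact: filter_uniq. Qed.

Let level_uniq j : uniq (level j). Proof. exact: filter_uniq. Qed.

Let mem_up j a : (a \in up j) = (j < lev a) && (a \in T).
Proof. exact: mem_filter. Qed.

Let mem_level j a : (a \in level j) = (lev a == j) && (a \in T).
Proof. exact: mem_filter. Qed.

Let memT a : a \in T -> a \in u :: T.
Proof. by rewrite inE orbC => ->. Qed.

Let clique_opath l a b : uniq l ->
  {in l &, forall c d, c != d -> ore c d} -> a \in l -> b \in l -> a != b ->
  opath a b l.
Proof.
move=> ul cl al bl ab.
have bl' : b \in rem a l by rewrite mem_rem_uniq // inE eq_sym ab.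
have pe : perm_eq (a :: rcons (rem b (rem a l)) b) l.
  rewrite perm_sym; apply: perm_trans (perm_to_rem al) _.
  by rewrite perm_cons -cats1 perm_sym perm_catC perm_sym perm_to_rem.
have := @opath_path _ a (rcons (rem b (rem a l)) b).
rewrite last_rcons => h; apply: (opath_perm (h _) pe).
apply: clique_path; first by rewrite (perm_uniq pe).
by move=> c d; rewrite !(perm_mem pe); apply: cl.
Qed.

Let clique_start l a : uniq l ->
  {in l &, forall c d, c != d -> ore c d} -> a \in l ->
  exists b, b \in l /\ opath a b l.
Proof.
move=> ul cl al; have pe := perm_to_rem al; rewrite perm_sym in pe.
exists (last a (rem a l)); split; first by rewrite -(perm_mem pe) mem_last.
apply: (opath_perm _ pe); apply: opath_path; apply: clique_path.
  by rewrite (perm_uniq pe).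
by move=> c d; rewrite !(perm_mem pe); apply: cl.
Qed.

Let ore_near a b : a \in u :: T -> b \in u :: T -> a != b ->
  lev a <= (lev b).+1 -> lev b <= (lev a).+1 -> ore a b.
Proof. exact: chain_ore ch _ _. Qed.

Let ore_up a b : a \in u :: T -> b \in u :: T -> lev b = (lev a).+1 ->
  ore a b.
Proof.
move=> aT bT E; apply: ore_near; rewrite ?E //; last by clear; lia.
by apply/eqP=> ab; move: E; rewrite ab; clear; lia.
Qed.

(** From [a] sweep the level except [b], climb, cover the higher levels by induction, and descend to
    [b]. At [j = m] the levels [m] and [m+1] form one clique, so level [m+1] may have any size. *)
Let ends_level d j a b : j + d = m -> 0 < j -> a \in T -> b \in T -> a != b ->
  lev a = j -> lev b = j -> opath a b (up j.-1).
Proof.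
elim: d j a b => [|d IH] j a b jm j0 aT bT ab la lb.
  apply: clique_opath; rewrite ?mem_up ?la ?lb ?aT ?bT ?prednK ?leqnn //.
  move=> c e; rewrite !mem_up => /andP[lc cT] /andP[le eT] ce.
  have := chain_levels ch cT; have := chain_levels ch eT.
  move=> h1 h2; apply: ore_near; rewrite ?memT //.
    by move: h1 h2 lc le jm; clear; lia.
  by move: h1 h2 lc le jm; clear; lia.
have aL : a \in level j by rewrite mem_level la eqxx.
have bL : b \in level j by rewrite mem_level lb eqxx.
have aL' : a \in rem b (level j) by rewrite mem_rem_uniq ?level_uniq // inE ab.
have [||c [cL pc]] := clique_start (l := rem b (level j)) _ _ aL'.
- by rewrite rem_uniq ?level_uniq.
- move=> c e /mem_rem; rewrite mem_level => /andP[/eqP lc cT].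
  move=> /mem_rem; rewrite mem_level => /andP[/eqP le eT] ce.
  by apply: ore_near; rewrite ?memT ?lc ?le.
have [a' [b' [a'T b'T ab' la' lb']]] : exists a b,
    [/\ a \in T, b \in T, a != b, lev a = j.+1 & lev b = j.+1].
  by apply: two; move: jm; clear; lia.
have p1 := IH j.+1 a' b' ltac:(move: jm; clear; lia) isT a'T b'T ab' la' lb'.
move/mem_rem: cL; rewrite mem_level => /andP[/eqP lc cT].
have oca : ore c a'.
  by apply: ore_up; rewrite ?memT ?lc.
have obb : ore b' b.
  by rewrite ore_sym; apply: ore_up; rewrite ?memT ?lb.
apply: (opath_perm (opath_cat (opath_cat pc oca p1) obb (opath1 b))).
have := up_split j.-1; rewrite prednK // perm_sym => pe; apply: (perm_trans _ pe).
have := perm_to_rem bL => pb; rewrite perm_sym in pb.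
apply: (@perm_trans _ ((b :: rem b (level j)) ++ up j)).
  by perm_by_count.
by rewrite perm_cat2r.
Qed.

(** Whole levels are swept until the one below [x] is reached; then [ends_level] covers everything
    above and returns to [x]. *)
Let climb d j y x : lev x = j + d.+1 -> j <= m -> y \in u :: T -> lev y = j ->
  x \in T -> opath y x (y :: up j).
Proof.
elim: d j y x => [|d IH] j y x lx jm yT ly xT.
  case: (ltnP j m) => jm'.
    have [a [ax aT la]] : exists a, [/\ a != x, a \in T & lev a = j.+1].
      have [a [b [aT bT ab la lb]]] := two (j := j.+1) jm'.
      case: (eqVneq a x) => [E|]; last by exists a.
      by exists b; rewrite -E eq_sym.
    have p1 : opath a x (up j).
      apply: (@ends_level (m - j.+1) j.+1); rewrite // ?lx ?addn1 //.
      by rewrite subnKC.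
    by apply: (opath_cat (opath1 y) _ p1); apply: ore_up; rewrite ?ly ?(memT aT).
  have xU : x \in up j by rewrite mem_up lx xT addn1 leqnn.
  have pe := perm_to_rem xU; rewrite perm_sym in pe.
  have lU c : c \in up j -> c \in T /\ lev c = j.+1.
    rewrite mem_up => /andP[h cT]; split=> //.
    by have := chain_levels ch cT; move: h jm jm'; clear; lia.
  have := @opath_path _ y (rcons (rem x (up j)) x); rewrite last_rcons => h.
  apply: (opath_perm (h _) _); last first.
    by rewrite perm_cons -cats1 perm_catC.
  have pe' : perm_eq (rcons (rem x (up j)) x) (up j).
    by rewrite -cats1 perm_catC.
  have yU : y \notin up j by rewrite mem_up ly ltnn.
  apply: clique_path; first by rewrite /= (perm_mem pe') yU (perm_uniq pe') up_uniq.
  move=> a b; rewrite !inE !(perm_mem pe').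
  case/predU1P=> [->|/lU[aT la]] /predU1P[->|/lU[bT lb]] ab.
  - by rewrite eqxx in ab.
  - by apply: ore_up; rewrite ?ly ?(memT bT).
  - by rewrite ore_sym; apply: ore_up; rewrite ?ly ?(memT aT).
  - by apply: ore_near; rewrite ?(memT aT) ?(memT bT) // la lb.
have jm1 : j < m.
  have := chain_levels ch xT; rewrite lx; move: jm; clear; lia.
have [a [b [aT bT ab la lb]]] := two (j := j.+1) jm1.
have aL : a \in level j.+1 by rewrite mem_level la eqxx.
have [||c [cL pc]] := clique_start (l := level j.+1) _ _ aL.
- exact: level_uniq.
- move=> c e; rewrite !mem_level => /andP[/eqP lc cT] /andP[/eqP le eT] ce.
  by apply: ore_near; rewrite ?memT ?lc ?le.
move: cL; rewrite mem_level => /andP[/eqP lc cT].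
have oya : ore y a.
  by apply: ore_up; rewrite ?ly ?(memT aT).
have p2 := IH j.+1 c x ltac:(move: lx; clear; lia) jm1 (memT cT) lc xT.
have q1 : opath y c (y :: level j.+1).
  exact: opath_cat (opath1 y) oya pc.
have [s0 [ps0 ls0 pes0]] := p2.
have := opath_extend q1 ps0; rewrite ls0 => q2.
apply: (opath_perm q2); rewrite /= perm_cons perm_sym.
apply: perm_trans (up_split j) _; rewrite perm_cat2l perm_sym.
by move: pes0; rewrite perm_cons.
Qed.

Lemma chain_opath x : x \in T -> opath u x (u :: T).
Proof.
move=> xT.
have hx := chain_levels ch xT.
have p := @climb (lev x).-1 0 u x ltac:(move: hx; clear; lia) (leq0n m)
  (mem_head u T) (chain_root ch) xT.
apply: (opath_perm p); rewrite perm_cons.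
rewrite /up (eq_in_filter (a2 := predT)) ?filter_predT // => a aT.
by have := chain_levels ch aT; case: (lev a).
Qed.

End ChainPaths.

(** * Growing the two arcs *)

Section Frames.
Variables (G : sgraph) (C H : {set G}).
Implicit Types (x y z u v a b : G) (s l r X Y tp tm yp ym P : seq G).
Hypothesis obs : obstruction C H.
Local Notation theta := (theta C H).

(* [tp] and [tm] list the two sides of the arc, starting next to [u].  The
   paths are also required after shortening one of the sides, since they are
   used with a vertex of the arc in the role of the next vertex. *)
Definition good u tp tm :=
  (forall k, opath u (last u tp) (u :: tp ++ take k tm)) /\
  (forall k, opath u (last u tm) (u :: take k tp ++ tm)).

Lemma good_sym u tp tm : good u tp tm -> good u tm tp.
Proof.
case=> g1 g2; split=> k; [apply: opath_perm (g2 k) _ | apply: opath_perm (g1 k) _];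
  by rewrite perm_cons perm_catC.
Qed.

Lemma good_nil u : good u [::] [::].
Proof. by split=> k; apply: opath1. Qed.

Definition front s P := s ++ take 1 P.

(** Whether [a] lies on the side or is the first vertex beyond it, what precedes it is a shortened
    side, for which [good] has a path. *)
Lemma front_split s P a : a \in front s P ->
  exists A1 A2, s ++ P = A1 ++ a :: A2 /\ A1 = take (size A1) s.
Proof.
rewrite /front mem_cat => /orP[|].
  case/splitPr=> A1 A2; exists A1, (A2 ++ P).
  by rewrite -catA take_size_cat.
case: P => [|p P] //=; rewrite take0 inE => /eqP ->.
by exists s, P; rewrite take_size.
Qed.

Lemma front_sub s P : {subset front s P <= s ++ P}.
Proof. by move=> a /front_split[A1 [A2 [-> _]]]; rewrite mem_cat mem_head orbT. Qed.

(* [P1] and [P2] are the gaps between the arc around [u] with sides [tp], [tm]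
   and the arc around [v] with sides [yp], [ym]. *)
Record frame u v tp P1 yp tm P2 ym r : Prop := Frame {
  frame_theta : theta u v (tp ++ P1 ++ rev yp) (tm ++ P2 ++ rev ym) r;
  frame_good1 : good u tp tm;
  frame_good2 : good v yp ym }.

Lemma frame_flip u v tp P1 yp tm P2 ym r :
  frame u v tp P1 yp tm P2 ym r -> frame u v tm P2 ym tp P1 yp r.
Proof. by case=> /theta_flip th /good_sym g1 /good_sym g2. Qed.

Lemma frame_swap u v tp P1 yp tm P2 ym r :
  frame u v tp P1 yp tm P2 ym r ->
  frame v u yp (rev P1) tp ym (rev P2) tm (rev r).
Proof.
case=> /theta_swap th g1 g2; split => //.
by move: th; rewrite !rev_cat !revK -!catA.
Qed.

Lemma frame_gap u v tp P1 yp tm P2 ym r :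
  frame u v tp P1 yp tm P2 ym r -> exists p P, P1 = p :: P.
Proof.
case: P1 => [|p P]; last by exists p, P.
case=> th [_ g1] [_ g2]; exfalso.
apply: (balls_apart obs th).
- by have := g1 (size tp); rewrite take_size.
- by have := g2 (size yp); rewrite take_size.
Qed.

Lemma frame_H u v tp P1 yp tm P2 ym r a z :
  frame u v tp P1 yp tm P2 ym r -> a \in front tp P1 -> z \in H -> ~~ ore a z.
Proof.
case=> th [_ g1] _ /front_split[A1 [A2 [E EA]]] zH.
move: th; rewrite catA E -catA /= => th.
by apply: (frontier_H obs th) zH; rewrite EA.
Qed.

Lemma frame_opposite u v tp P1 yp tm P2 ym r a b :
  frame u v tp P1 yp tm P2 ym r ->
  a \in front tp P1 -> b \in front ym (rev P2) -> ~~ ore a b.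
Proof.
case=> th [_ g1] [g2 _] /front_split[A1 [A2 [E EA]]] /front_split[B1 [B2 [E' EB]]].
move: th; rewrite catA E -catA /= => th.
apply: (frontier_opposite obs (tm := tm) (B1 := B1) (B2 := B2) th).
- by rewrite !rev_cat revK E' -catA.
- by rewrite EA.
- by rewrite EB.
Qed.

Lemma frame_root u v tp P1 yp tm P2 ym r b :
  frame u v tp P1 yp tm P2 ym r -> b \in front ym (rev P2) -> ~~ ore u b.
Proof.
move=> fr /front_split[B1 [B2 [E' EB]]].
have [p [P EP]] := frame_gap fr; subst P1.
case: fr => th [_ g1] [g2 _].
move: th; rewrite catA => th.
apply: (root_frontier obs (B1 := B1) (B2 := B2 ++ rev tm) th).
- by case: (tp).
- by rewrite !rev_cat revK E' -catA.
- by rewrite EB.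
Qed.

Lemma frame_root_flip u v tp P1 yp tm P2 ym r b :
  frame u v tp P1 yp tm P2 ym r -> b \in front yp (rev P1) -> ~~ ore u b.
Proof. by move/frame_flip/frame_root; apply. Qed.

Lemma frame_root_swap u v tp P1 yp tm P2 ym r a :
  frame u v tp P1 yp tm P2 ym r ->
  a \in front tp P1 ++ front tm P2 -> ~~ ore v a.
Proof.
move=> /frame_swap fr; rewrite mem_cat => /orP[] aI.
  by apply: (frame_root_flip fr); rewrite revK.
by apply: (frame_root fr); rewrite revK.
Qed.

Definition light a b := degree a + degree b < graph_order G.

(** Pairs inside [X] or inside [Y] may still be heavy. Lightness is demanded of adjacent pairs too,
    since the matching of degree sums in [frame_clean] does not see edges. *)
Definition clean u X Y :=
  [&& all (light u) X, all (light u) Y & all (fun a => all (light a) Y) X].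

Lemma not_clean u X Y : ~~ clean u X Y ->
  [\/ exists2 a, a \in X & ~~ light u a, exists2 a, a \in Y & ~~ light u a
    | exists a b, [/\ a \in X, b \in Y & ~~ light a b]].
Proof.
rewrite /clean !negb_and => /or3P[/allPn h|/allPn h|/allPn[a aX /allPn[b bY h]]].
- by constructor 1.
- by constructor 2.
- by constructor 3; exists a, b.
Qed.

Lemma frame_neq u v tp P1 yp tm P2 ym r :
  frame u v tp P1 yp tm P2 ym r ->
  {in front tp P1 & front ym (rev P2), forall a b, a != b} /\
  forall a, [|| a \in front tp P1, a \in front tm P2,
    a \in front yp (rev P1) | a \in front ym (rev P2)] -> (u != a) && (v != a).
Proof.
move=> fr; have := theta_uniq (frame_theta fr).
have s1 : {subset front tp P1 <= tp ++ P1 ++ rev yp}.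
  by move=> a /front_sub aI; rewrite catA mem_cat aI.
have s2 : {subset front tm P2 <= tm ++ P2 ++ rev ym}.
  by move=> a /front_sub aI; rewrite catA mem_cat aI.
have s3 : {subset front yp (rev P1) <= tp ++ P1 ++ rev yp}.
  move=> a /front_sub; rewrite !mem_cat !mem_rev.
  by case/orP=> ->; rewrite !orbT.
have s4 : {subset front ym (rev P2) <= tm ++ P2 ++ rev ym}.
  move=> a /front_sub; rewrite !mem_cat !mem_rev.
  by case/orP=> ->; rewrite !orbT.
move: s1 s2 s3 s4; set S1 := tp ++ _; set S2 := tm ++ _ => s1 s2 s3 s4.
rewrite !cons_uniq cat_uniq inE negb_or => /and3P[/andP[_ un] vn /and3P[_ dis _]].
split=> [a b /s1 aS /s4 bS|a aI].
  apply: contraTneq aS => ->; apply: contra dis => bS1.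
  by apply/hasP; exists b.
have aS : a \in S1 ++ S2.
  by rewrite mem_cat; case/or4P: aI => [/s1|/s2|/s3|/s4] ->; rewrite ?orbT.
by apply/andP; split; [apply: contraNneq un|apply: contraNneq vn] => ->.
Qed.

(* The degree sums of a failing pair at [u] and of one at [v] add up to [2n],
   and the four vertices can be matched into two pairs of degree sum below
   [n]. *)
Lemma frame_clean u v tp P1 yp tm P2 ym r :
  frame u v tp P1 yp tm P2 ym r ->
  clean u (front tp P1) (front tm P2) ||
  clean v (front yp (rev P1)) (front ym (rev P2)).
Proof.
move=> fr; apply/negPn/negP; rewrite negb_or => /andP[/not_clean nu /not_clean nv].
have [ne ne0] := frame_neq fr; have [ne' _] := frame_neq (frame_flip fr).
have pm a b : a \in front tp P1 -> b \in front ym (rev P2) -> light a b.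
  by move=> aI bI; apply: nore_light; rewrite ?ne // (frame_opposite fr).
have mp a b : a \in front tm P2 -> b \in front yp (rev P1) -> light a b.
  move=> aI bI; apply: nore_light; rewrite ?ne' //.
  exact: (frame_opposite (frame_flip fr)).
have up b : b \in front yp (rev P1) -> light u b.
  move=> bI; apply: nore_light; last exact: (frame_root_flip fr).
  by have /andP[] : (u != b) && (v != b) by apply: ne0; rewrite bI !orbT.
have um b : b \in front ym (rev P2) -> light u b.
  move=> bI; apply: nore_light; last exact: (frame_root fr).
  by have /andP[] : (u != b) && (v != b) by apply: ne0; rewrite bI !orbT.
have vp a : a \in front tp P1 -> light v a.
  move=> aI; apply: nore_light; last first.
    by apply: (frame_root_swap fr); rewrite mem_cat aI.
  by have /andP[] : (u != a) && (v != a) by apply: ne0; rewrite aI.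
have vm a : a \in front tm P2 -> light v a.
  move=> aI; apply: nore_light; last first.
    by apply: (frame_root_swap fr); rewrite mem_cat aI orbT.
  by have /andP[] : (u != a) && (v != a) by apply: ne0; rewrite aI orbT.
have sum a b c d : light a c -> light b d -> ~~ light a b -> ~~ light c d -> False.
  by rewrite /light; clear; lia.
have lsym a b : light a b -> light b a by rewrite /light addnC.
have nsym a b : ~~ light a b -> ~~ light b a by apply: contra; apply: lsym.
case: nu => [[a aI na]|[a aI na]|[a [b [aI bI na]]]];
case: nv => [[c cI nc]|[c cI nc]|[c [d [cI dI nc]]]].
- exact: (sum _ _ _ _ (up _ cI) (lsym _ _ (vp _ aI)) na (nsym _ _ nc)).
- exact: (sum _ _ _ _ (um _ cI) (lsym _ _ (vp _ aI)) na (nsym _ _ nc)).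
- exact: (sum _ _ _ _ (up _ cI) (pm _ _ aI dI) na nc).
- exact: (sum _ _ _ _ (up _ cI) (lsym _ _ (vm _ aI)) na (nsym _ _ nc)).
- exact: (sum _ _ _ _ (um _ cI) (lsym _ _ (vm _ aI)) na (nsym _ _ nc)).
- exact: (sum _ _ _ _ (um _ dI) (mp _ _ aI cI) na (nsym _ _ nc)).
- exact: (sum _ _ _ _ (lsym _ _ (vp _ aI)) (mp _ _ bI cI) na nc).
- exact: (sum _ _ _ _ (pm _ _ aI cI) (lsym _ _ (vm _ bI)) na (nsym _ _ nc)).
- exact: (sum _ _ _ _ (pm _ _ aI dI) (mp _ _ bI cI) na (nsym _ _ nc)).
Qed.

End Frames.

(** * Extending one side of an arc *)

Section Growth.
Variables (G : sgraph) (C H : {set G}).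
Implicit Types (x y z u v a b f t : G) (s l r X Y tp tm yp ym P : seq G).
Implicit Types (lev : G -> nat) (star : bool).
Hypothesis obs : obstruction C H.
Local Notation theta := (theta C H).
Local Notation frame := (frame C H).

(** Both sides meet the levels up to [m], so either can play the skeleton [L], and every such level
    has the two vertices that spanning paths require. Level [m+1] is the unfinished one. *)
Definition two_sided tp tm lev m := forall j, 0 < j <= m ->
  (exists2 a, a \in tp & lev a = j) /\ (exists2 a, a \in tm & lev a = j).

Lemma light_sym a b : light a b = light b a.
Proof. by rewrite /light addnC. Qed.

Lemma clean_light u X Y : clean u X Y ->
  [/\ {in X, forall a, light u a}, {in Y, forall a, light u a}
    & {in X & Y, forall a b, light a b}].
Proof.
case/and3P=> /allP h1 /allP h2 /allP h3; split=> // a b aX bY.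
exact: (allP (h3 a aX)).
Qed.

(* Two heavy pairs, one inside each class, would give a heavy mixed pair. *)
Lemma clean_light_side u X Y : clean u X Y ->
  {in X &, forall a b, a != b -> light a b} \/
  {in Y &, forall a b, a != b -> light a b}.
Proof.
case/clean_light=> _ _ hXY.
case: (boolP (all (fun a => all (fun b => (a == b) || light a b) X) X)).
  move=> /allP h; left=> a b aX bX ab.
  by have := allP (h a aX) b bX; rewrite (negPf ab).
case/allPn=> a aX /allPn[b bX]; rewrite negb_or => /andP[_ nab].
right=> c d cY dY _; have := hXY a c aX cY; have := hXY b d bX dY.
by move: nab; rewrite /light; clear; lia.
Qed.

Lemma ore_neq a b : ore a b -> a != b. Proof. by case/andP. Qed.

(** The skeleton [L] is the side whose inner pairs are light by [clean_light_side]; its vertices are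
    then light towards every other vertex of both sides, so their [ore]-pairs are edges. *)
Lemma grow_chain star u X Y tp tm lev m f t z z' :
  chain u (tp ++ tm) lev m -> two_sided tp tm lev m ->
  {subset tp <= X} -> {subset tm <= Y} -> f \in X ++ Y ->
  f \notin u :: tp ++ tm -> clean u X Y ->
  t \in u :: tp ++ tm -> edge f t -> lev t <= m ->
  edge u z -> {in X ++ Y, forall a, (z != a) && ~~ ore a z} ->
  (if star then edge u f /\ {in tp ++ tm, forall a, lev a = 1}
   else [/\ edge z z', ~~ ore u z' & {in X ++ Y, forall a, ~~ ore a z'}]) ->
  exists lev', [/\ chain u (f :: tp ++ tm) lev' m,
    {in u :: tp ++ tm, lev' =1 lev} & star -> lev' f = 1].
Proof.
move=> ch ts sX sY fXY fT cl tT ft tm' uz nz st.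
have TXY a : a \in tp ++ tm -> a \in X ++ Y.
  by rewrite !mem_cat => /orP[/sX->|/sY->]; rewrite ?orbT.
have fTXY a : a \in f :: tp ++ tm -> a \in X ++ Y.
  by rewrite inE => /predU1P[->|/TXY].
have [luX luY lXY] := clean_light cl.
have lu a : a \in X ++ Y -> light u a by rewrite mem_cat => /orP[/luX|/luY].
have [L [LT Lm Ll]] : exists L : seq G, [/\ {subset L <= tp ++ tm},
    forall j, 0 < j <= m -> exists2 c, c \in L & lev c = j &
    {in L & X ++ Y, forall c a, c != a -> light c a}].
  case: (clean_light_side cl) => lS; [exists tp | exists tm]; split.
  - by move=> a aI; rewrite mem_cat aI.
  - by move=> j /ts[].
  - move=> c a cI; rewrite mem_cat => /orP[aX|aY] ca.
      by apply: lS => //; apply: sX.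
    by apply: lXY => //; apply: sX.
  - by move=> a aI; rewrite mem_cat aI orbT.
  - by move=> j /ts[].
  - move=> c a cI; rewrite mem_cat => /orP[aX|aY] ca.
      by rewrite light_sym; apply: lXY => //; apply: sY.
    by apply: lS => //; apply: sY.
have Ledge : {in u :: L & [:: u, f & tp ++ tm],
    forall c a, ore c a -> edge c a}.
  move=> c a cI aI oca; have ca := ore_neq oca; apply: ore_light => //.
  move: cI; rewrite inE => /predU1P[E|cL]; move: aI; rewrite inE.
    case/predU1P=> [Ea|/fTXY aXY]; first by rewrite E Ea eqxx in ca.
    by rewrite E; apply: lu.
  case/predU1P=> [->|/fTXY aXY]; last exact: Ll.
  by rewrite addnC; apply: lu; apply/TXY/LT.
have nzT : {in f :: tp ++ tm, forall a, ~~ ore a z}.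
  by move=> a /fTXY/nz/andP[].
have lf i a : a \in u :: tp ++ tm -> add_level f lev i a = lev a.
  by move=> aT; rewrite /add_level; case: eqP aT fT => // -> ->.
case: star st => [[uf lev1]|[zz uz' nz']].
  exists (add_level f lev 0); split.
  - apply: (chain_extend_star ch (obs_claw obs) LT Ledge fT uz nzT) => //.
    by apply/negP=> /fTXY/nz; rewrite eqxx.
  - exact: lf.
  - by rewrite /add_level eqxx.
pose Q i := has (fun t => edge f t && (lev t == i)) (u :: tp ++ tm).
have exQ : exists i, Q i.
  by exists (lev t); apply/hasP; exists t => //; rewrite ft eqxx.
have [i /hasP[t0 t0T h0] imin] := find_ex_minn exQ.
exists (add_level f lev i); split => //; last exact: lf.
apply: (chain_extend ch (obs_claw obs) (obs_wounded obs) LT Lm Ledge fT uz nzT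
  zz uz').
- by move=> a /fTXY/nz'.
- by exists t0.
- by apply: leq_trans (imin _ _) tm'; apply/hasP; exists t => //; rewrite ft eqxx.
- by move=> t1 t1T ft1; apply: imin; apply/hasP; exists t1 => //; rewrite ft1 eqxx.
Qed.

Definition rooted star u tp tm :=
  tp = [::] /\ tm = [::] \/
  exists lev m, [/\ chain u (tp ++ tm) lev m, 0 < m, two_sided tp tm lev m
    & star -> {in tp ++ tm, forall a, lev a = 1}].

(* [star] holds if [u] is adjacent to [v] and no path [u], [z], [z'] suitable
   as an arm is available; then the arc never has a second level. *)
Definition tailed star u v := exists z, [/\ z \in H, edge u z &
  if star then edge u v /\ edge v z
  else exists z', [/\ edge z z', ~~ ore u z' & z' \in H \/ z' = v]].

Lemma chain_mem u T T' lev m : T =i T' -> chain u T lev m -> chain u T' lev m.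
Proof.
move=> E; have E' a : (a \in u :: T') = (a \in u :: T) by rewrite !inE E.
case=> h1 h2 h3 h4; split => //.
- by move=> a; rewrite -E; apply: h2.
- by move=> a b; rewrite !E'; apply: h3.
- by move=> a b; rewrite !E'; apply: h4.
Qed.

Lemma rooted_sym star u tp tm : rooted star u tp tm -> rooted star u tm tp.
Proof.
case=> [[-> ->]|[lev [m [ch m0 ts st]]]]; first by left.
right; exists lev, m; split => //.
- by apply: chain_mem ch => a; rewrite !mem_cat orbC.
- by move=> j /ts[].
- by move=> /st h a; rewrite mem_cat orbC -mem_cat; apply: h.
Qed.

Lemma clean_sym u X Y : clean u X Y -> clean u Y X.
Proof.
case/clean_light=> h1 h2 h3; apply/and3P; split; apply/allP => // a aY.
by apply/allP=> b bX; rewrite light_sym h3.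
Qed.

Section Tails.
Variables (star : bool) (u v : G) (tp P1 yp tm P2 ym r : seq G).
Hypothesis fr : frame u v tp P1 yp tm P2 ym r.
Hypothesis cl : clean u (front tp P1) (front tm P2).

Lemma tail_nore z : z \in H ->
  {in front tp P1 ++ front tm P2, forall a, (z != a) && ~~ ore a z}.
Proof.
move=> zH a; rewrite mem_cat => aI.
have aC : a \in C.
  rewrite -(theta_C (frame_theta fr)) !inE mem_cat.
  by case/orP: aI => /front_sub h; rewrite !catA !(mem_cat _ _ (rev _)) h !orbT.
apply/andP; split; first by apply: contraNneq (obs_disjoint obs zH) => ->.
case/orP: aI => aI; first exact: (frame_H obs fr).
exact: (frame_H obs (frame_flip fr)).
Qed.

Lemma tail_end_nore z : z \in H \/ z = v ->
  {in front tp P1 ++ front tm P2, forall a, ~~ ore a z}.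
Proof.
move=> [zH|->] a aI; first by have /andP[] := tail_nore zH aI.
by rewrite ore_sym; apply: (frame_root_swap obs fr).
Qed.

(* If [u], [v] and [z] form a triangle, the vertex following the neighbours
   of [u] would be the end of a light copy of the wounded graph on it. *)
Lemma star_root p P z tp' x : P1 = p :: P -> tp = rcons tp' x ->
  z \in H -> edge u z -> edge v z -> edge u v -> edge u x -> edge u p.
Proof.
move=> E1 Et zH uz vz uv ux; apply/negPn/negP=> nup.
have [q [Q EQ]] := frame_gap obs (frame_flip (frame_swap fr)).
have xF : x \in front tp P1 by rewrite /front Et mem_cat mem_rcons mem_head.
have pF : p \in front tp P1.
  by rewrite /front E1 /= take0 mem_cat mem_head orbT.
have [b bF vb] : exists2 b, b \in front ym (rev P2) & edge v b.
  have := theta_path2 (frame_theta (frame_swap fr)).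
  rewrite EQ /front; case: (ym) => [|b ym'] /=; rewrite ?take0 => /andP[vb _].
    by exists q; rewrite ?mem_head.
  by exists b; rewrite ?mem_head.
have xp : edge x p.
  have := theta_path1 (frame_theta fr); rewrite Et E1 => /path_rcons_cat[_].
  by rewrite last_rcons /= => /andP[].
have vu : edge v u by rewrite edge_sym.
have zF a : a \in front tp P1 -> ~~ ore z a.
  by move=> aF; rewrite ore_sym; apply: (frame_H obs fr).
have vF a : a \in front tp P1 -> ~~ ore v a.
  by move=> aF; apply: (frame_root_swap obs fr); rewrite mem_cat aF.
have bFF a : a \in front tp P1 -> ~~ ore b a.
  by move=> aF; rewrite ore_sym; apply: (frame_opposite obs fr).
apply: (wounded_ore (obs_wounded obs) vu vz uz vb ux xp); auto.
- exact: (frame_root obs fr).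
- apply: light_nore => //; have [h _ _] := clean_light cl; exact: h.
- rewrite ore_sym; apply: (frame_H obs (frame_flip (frame_swap fr))) zH.
  exact: bF.
Qed.

End Tails.

(** The bound on the level of [last u tp] gives [p] a neighbour on a finished level. Paths ending in
    [p] prolong old ones by an edge; the path to the other end that also covers [p] comes from
    [chain_opath]. *)
Lemma grow_side star u v tp p P yp tm P2 ym r lev m :
  frame u v tp (p :: P) yp tm P2 ym r ->
  clean u (front tp (p :: P)) (front tm P2) -> tailed star u v ->
  chain u (tp ++ tm) lev m -> 0 < m -> two_sided tp tm lev m ->
  (star -> {in tp ++ tm, forall a, lev a = 1}) -> lev (last u tp) <= m ->
  good u (rcons tp p) tm /\ rooted star u (rcons tp p) tm.
Proof.
move=> fr cl [z [zH uz st]] ch m0 ts lev1 lm.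
have uniqF : uniq (u :: tp ++ p :: tm).
  apply: subseq_uniq (theta_uniq (frame_theta fr)).
  apply: (@cat_subseq _ [:: u] _ [:: u] _ (subseq_refl _)).
  apply: (@subseq_trans _ (tp ++ p :: P ++ rev yp ++ tm ++ P2 ++ rev ym)).
    rewrite cat_subseq //= eqxx.
    apply: (subseq_trans (prefix_subseq tm (P2 ++ rev ym))).
    by rewrite [P ++ _]catA suffix_subseq.
  by rewrite -!catA; apply: subseq_cons.
have pT : p \notin u :: tp ++ tm.
  by move: uniqF; rewrite (perm_uniq (_ : perm_eq _ (p :: u :: tp ++ tm)));
    [case/andP | perm_by_count].
have xT : last u tp \in u :: tp ++ tm.
  by rewrite -cat_cons mem_cat mem_last.
have [a0 a0T _] : exists2 a, a \in tp & lev a = 1 by case: (ts 1 m0).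
have [tp' [x Et]] : exists tp' x, tp = rcons tp' x.
  by case/lastP: (tp) a0T => // tp' x _; exists tp', x.
have px : edge (last u tp) p.
  have := theta_path1 (frame_theta fr) => /path_rcons_cat[_].
  by rewrite /= => /andP[].
have XE : front tp (p :: P) = rcons tp p by rewrite /front /= take0 cats1.
have [z' st'] : exists z', if star
    then edge u p /\ {in tp ++ tm, forall a, lev a = 1}
    else [/\ edge z z', ~~ ore u z' & {in front tp (p :: P) ++ front tm P2,
      forall a, ~~ ore a z'}].
  case: star st lev1 => [[uv vz] lev1|[z' [zz uz' z'H]] _].
    exists z; split; last exact: lev1.
    apply: (star_root fr cl (erefl _) Et zH) => //.
    have xI : x \in tp ++ tm by rewrite Et mem_cat mem_rcons mem_head.
    apply: ore_light; last first.
      have [h _ _] := clean_light cl; apply: h.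
      by rewrite XE Et mem_rcons inE mem_rcons mem_head orbT.
    apply: (chain_ore ch); rewrite ?mem_head ?inE ?xI ?orbT //.
    - apply: contraTneq uniqF => ->; rewrite /= mem_cat Et mem_rcons mem_head.
      by [].
    - by rewrite (chain_root ch).
    - by rewrite (lev1 isT) // (chain_root ch).
  by exists z'; split => //; apply: (tail_end_nore fr).
have [lev' [ch' eqlev lf]] : exists lev', [/\ chain u (p :: tp ++ tm) lev' m,
    {in u :: tp ++ tm, lev' =1 lev} & star -> lev' p = 1].
  apply: (grow_chain ch ts _ _ _ pT cl xT _ lm uz (tail_nore fr zH) st').
  - by move=> a aI; rewrite /front mem_cat aI.
  - by move=> a aI; rewrite /front mem_cat aI.
  - by rewrite mem_cat XE mem_rcons mem_head.
  - by rewrite edge_sym.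
have eqT a : a \in tp ++ tm -> lev' a = lev a.
  by move=> aI; rewrite eqlev // inE aI orbT.
have memE : p :: tp ++ tm =i rcons tp p ++ tm.
  by move=> a; rewrite !(inE, mem_cat, mem_rcons) orbA.
have ch2 := chain_mem memE ch'.
have ts2 : two_sided (rcons tp p) tm lev' m.
  move=> j /ts[[a aI la] [b bI lb]]; split.
    exists a; first by rewrite mem_rcons inE aI orbT.
    by rewrite eqT // mem_cat aI.
  by exists b => //; rewrite eqT // mem_cat bI orbT.
have uniq2 : uniq (u :: rcons tp p ++ tm) by rewrite cat_rcons.
split; last first.
  right; exists lev', m; split => // /[dup] /lf lp /lev1 h a.
  by rewrite -memE inE => /predU1P[->|aI]; rewrite // eqT // h.
have [g1 g2] := frame_good1 fr.
split=> k.
  rewrite last_rcons; apply: (opath_perm (opath_extend (g1 k) (s := [:: p]) _)).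
    by rewrite /= edge_ore.
  by perm_by_count.
case: (leqP k (size tp)) => hk.
  by have := g2 k; rewrite -cats1 takel_cat.
rewrite take_oversize ?size_rcons //.
apply: (chain_opath ch2 uniq2).
  move=> j /ts2[[a aI la] [b bI lb]]; exists a, b; split => //.
  - by rewrite mem_cat aI.
  - by rewrite mem_cat bI orbT.
  have := uniq2; rewrite cons_uniq cat_uniq => /and4P[_ _ dis _].
  apply: contraNneq dis => E; apply/hasP; exists b => //.
  by rewrite -E.
have [_ [b bI _]] := ts 1 m0.
rewrite mem_cat; apply/orP; right.
case: (tm) bI => //= c l _; exact: mem_last.
Qed.

End Growth.

(** * Growing until the gaps are exhausted *)

Section Contradiction.
Variables (G : sgraph) (C H : {set G}).
Implicit Types (x y z u v a b f t : G) (s l r X Y tp tm yp ym P : seq G).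
Implicit Types (lev : G -> nat) (star : bool).
Hypothesis obs : obstruction C H.
Local Notation theta := (theta C H).
Local Notation frame := (frame C H).
Local Notation tailed := (tailed H).

Lemma chain_raise u T lev m : chain u T lev m -> chain u T lev m.+1.
Proof.
case=> h1 h2 h3 h4; split => // a /h2 /andP[-> h] /=.
exact: leq_trans h _.
Qed.

Definition grown star u tp P1 tm P2 := exists tp' P1' tm' P2',
  [/\ tp' ++ P1' = tp ++ P1, tm' ++ P2' = tm ++ P2,
    size P1' + size P2' < size P1 + size P2, good u tp' tm'
    & rooted star u tp' tm'].

Lemma grown_sym star u tp P1 tm P2 :
  grown star u tp P1 tm P2 -> grown star u tm P2 tp P1.
Proof.
case=> tp' [P1' [tm' [P2' [e1 e2 lt g rt]]]].
exists tm', P2', tp', P1'; split => //; first by rewrite addnC [X in _ < X]addnC.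
- exact: good_sym.
- exact: rooted_sym.
Qed.

(** Both cycle neighbours of [u] enter in one round, since level 1 has to be met on both sides
    before [m] can be raised from 0 to 1. *)
Lemma grow_start star u v P1 yp P2 ym r : frame u v [::] P1 yp [::] P2 ym r ->
  tailed star u v -> clean u (front [::] P1) (front [::] P2) ->
  grown star u [::] P1 [::] P2.
Proof.
move=> fr [z [zH uz st]] cl.
have [p [P EP]] := frame_gap obs fr.
have [q [Q EQ]] := frame_gap obs (frame_flip fr); subst P1 P2.
have th := frame_theta fr.
have up : edge u p by have /andP[] := theta_path1 th.
have uq : edge u q by have /andP[] := theta_path2 th.
have nz := tail_nore obs fr zH.
rewrite /front /= !take0 in cl nz.
have pq : p != q.
  have := theta_uniq th; rewrite /= => /and4P[_ _ + _].
  by apply: contraNneq => ->; rewrite !mem_cat inE eqxx !orbT.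
have [z' st'] : exists z', if star then True
    else [/\ edge z z', ~~ ore u z' & {in [:: p] ++ [:: q],
      forall a, ~~ ore a z'}].
  case: star st => [_|[z' [zz uz' z'H]]]; first by exists z.
  exists z'; split => //.
  by have := tail_end_nore obs fr z'H; rewrite /front /= !take0.
have ch0 : chain u ([::] ++ [::]) (fun=> 0) 0.
  by split=> // a b; rewrite !inE => /eqP -> /eqP ->; rewrite ?eqxx.
have ts0 tp tm lev : two_sided tp tm lev 0 by case.
have [lev1 [ch1 e1 s1]] : exists lev', [/\ chain u (p :: [::] ++ [::]) lev' 0,
    {in u :: [::] ++ [::], lev' =1 fun=> 0} & star -> lev' p = 1].
  apply: (@grow_chain _ _ _ obs star u [:: p] [:: q] [::] [::] _ 0 p u z z'
    ch0) => //.
  - by rewrite mem_head.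
  - by rewrite inE eq_sym edge_neq.
  - by rewrite mem_head.
  - by rewrite edge_sym.
  - by case: (star) st' => // _; split.
have [lev2 [ch2 e2 s2]] : exists lev', [/\ chain u (q :: [:: p] ++ [::]) lev' 0,
    {in u :: [:: p] ++ [::], lev' =1 lev1} & star -> lev' q = 1].
  apply: (@grow_chain _ _ _ obs star u [:: p] [:: q] [:: p] [::] _ 0 q u z z'
    ch1) => //.
  - by rewrite mem_cat mem_head orbT.
  - by rewrite !inE negb_or eq_sym (edge_neq uq) eq_sym.
  - by rewrite mem_head.
  - by rewrite edge_sym.
  - by rewrite (chain_root ch1).
  - by case: (star) st' s1 => // _ s1; split => // a; rewrite inE => /eqP ->; apply: s1.
have lp : lev2 p = 1.
  have : 0 < lev2 p <= 1 by apply: (chain_levels ch2); rewrite !inE eqxx orbT.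
  by case: (lev2 p) => [|[|]].
have lq : lev2 q = 1.
  have : 0 < lev2 q <= 1 by apply: (chain_levels ch2); rewrite !inE eqxx.
  by case: (lev2 q) => [|[|]].
have opq : ore p q.
  by apply: (chain_ore ch2); rewrite ?lp ?lq ?inE ?eqxx ?orbT.
exists [:: p], P, [:: q], Q; split => //=; first by clear; lia.
- split=> -[|k] /=; rewrite ?take0.
  + by exists [:: p]; rewrite /= edge_ore.
  + exists [:: q; p]; rewrite /= edge_ore // ore_sym opq; split=> //.
    by rewrite perm_cons (perm_catC [:: q] [:: p]).
  + by exists [:: q]; rewrite /= edge_ore.
  + by exists [:: p; q]; rewrite /= edge_ore // opq.
right; exists lev2, 1; split => //.
- apply: chain_raise; apply: chain_mem ch2 => a.
  by rewrite !inE orbC.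
- by move=> [|[|j]] // _; split; [exists p|exists q]; rewrite ?mem_head.
- by move=> _ a; rewrite !inE => /orP[] /eqP ->.
Qed.

(** A side that has not reached level [m+1] is extended; once both have reached it, that level is
    two-sided and [m] is raised first. *)
Lemma grow_frame star u v tp P1 yp tm P2 ym r :
  frame u v tp P1 yp tm P2 ym r -> rooted star u tp tm -> tailed star u v ->
  clean u (front tp P1) (front tm P2) -> grown star u tp P1 tm P2.
Proof.
move=> fr rt tl cl.
have [p [P EP]] := frame_gap obs fr.
have [q [Q EQ]] := frame_gap obs (frame_flip fr).
case: rt => [[Ep Em]|[lev [m [ch m0 ts lev1]]]].
  by move: fr cl; rewrite Ep Em => fr; apply: grow_start fr tl.
have low m' tp' : (forall a, a \in tp' -> lev a <= m'.+1) ->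
    ~~ has (fun a => lev a == m'.+1) tp' -> lev (last u tp') <= m'.
  move=> h /hasPn hn.
  have : last u tp' = u \/ last u tp' \in tp'.
    by case: (tp') => [|c l]; [left | right; rewrite /= mem_last].
  case=> [->|aI]; first by rewrite (chain_root ch).
  by have := h _ aI; rewrite leq_eqVlt (negPf (hn _ aI)).
have ch' : chain u (tm ++ tp) lev m.
  by apply: chain_mem ch => a; rewrite !mem_cat orbC.
have le1 a : a \in tp ++ tm -> lev a <= m.+1.
  by move=> aI; have /andP[] := chain_levels ch aI.
have fr1 : frame u v tp (p :: P) yp tm P2 ym r by rewrite -EP.
have cl1 : clean u (front tp (p :: P)) (front tm P2) by rewrite -EP.
have fr2 : frame u v tm (q :: Q) ym tp P1 yp r.
  by rewrite -EQ; apply: frame_flip fr.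
have cl2 : clean u (front tm (q :: Q)) (front tp P1).
  by rewrite -EQ; apply: clean_sym.
have le_tp a : a \in tp -> lev a <= m.+1.
  by move=> aI; apply: le1; rewrite mem_cat aI.
have le_tm a : a \in tm -> lev a <= m.+1.
  by move=> aI; apply: le1; rewrite mem_cat aI orbT.
case: (boolP (has (fun a => lev a == m.+1) tp)) => hp; last first.
  have [g rt] := grow_side obs fr1 cl1 tl ch m0 ts lev1 (low _ _ le_tp hp).
  by exists (rcons tp p), P, tm, P2; rewrite EP cat_rcons; split.
case: (boolP (has (fun a => lev a == m.+1) tm)) => hm; last first.
  apply: grown_sym.
  have ts2 : two_sided tm tp lev m by move=> j /ts[].
  have lev2 : star -> {in tm ++ tp, forall a, lev a = 1}.
    by move=> /lev1 h a; rewrite mem_cat orbC -mem_cat; apply: h.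
  have [g rt] := grow_side obs fr2 cl2 tl ch' m0 ts2 lev2 (low _ _ le_tm hm).
  by exists (rcons tm q), Q, tp, P1; rewrite EQ cat_rcons; split.
have ts' : two_sided tp tm lev m.+1.
  move=> j /andP[j0]; rewrite leq_eqVlt => /predU1P[->|jm].
    split; first by case/hasP: hp => a aI /eqP la; exists a.
    by case/hasP: hm => a aI /eqP la; exists a.
  by apply: ts; rewrite j0.
have ll : lev (last u tp) <= m.+1.
  have : last u tp = u \/ last u tp \in tp.
    by case: (tp) => [|c l]; [left | right; rewrite /= mem_last].
  by case=> [->|]; [rewrite (chain_root ch) | apply: le_tp].
have [g rt] := grow_side obs fr1 cl1 tl (chain_raise ch) (ltn0Sn m) ts' lev1 ll.
by exists (rcons tp p), P, tm, P2; rewrite EP cat_rcons; split.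
Qed.

(** Which root is clean may change from round to round, so the induction is on the total size of the
    gaps, and both roots keep their invariants. *)
Lemma no_frame su sv u v tp P1 yp tm P2 ym r :
  frame u v tp P1 yp tm P2 ym r ->
  rooted su u tp tm -> rooted sv v yp ym ->
  tailed su u v -> tailed sv v u -> False.
Proof.
have [k] := ubnP (size P1 + size P2).
elim: k => // k IH in u v tp P1 yp tm P2 ym r su sv *.
move=> hk fr ru rv tu tv.
case/orP: (frame_clean obs fr) => cl.
  have [tp' [P1' [tm' [P2' [e1 e2 lt g rt]]]]] := grow_frame fr ru tu cl.
  apply: (IH u v tp' P1' yp tm' P2' ym r su sv) => //.
    exact: leq_trans lt hk.
  case: fr => th _ g2; split => //.
  by rewrite [tp' ++ _]catA e1 [tm' ++ _]catA e2 -!catA.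
have fr' := frame_swap fr.
have [yp' [P1' [ym' [P2' [e1 e2 lt g rt]]]]] := grow_frame fr' rv tv cl.
apply: (IH v u yp' P1' tp ym' P2' tm (rev r) sv su) => //.
  by apply: leq_trans lt _; rewrite !size_rev.
case: fr' => th _ g2; split => //.
by rewrite [yp' ++ _]catA e1 [ym' ++ _]catA e2 -!catA.
Qed.

Lemma path_cross (e : rel G) (Q : pred G) x s : path e x s -> Q x ->
  ~~ Q (last x s) ->
  exists a b, [/\ e a b, a \in x :: s, b \in x :: s, Q a & ~~ Q b].
Proof.
elim: s x => [|y s IH] x /=; first by move=> _ ->.
case/andP=> exy ps Qx nl; case: (boolP (Q y)) => Qy.
  have [a [b [eab aI bI Qa Qb]]] := IH y ps Qy nl.
  by exists a, b; split => //; rewrite inE ?aI ?bI orbT.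
by exists x, y; split => //; rewrite !inE eqxx ?orbT.
Qed.

(** If [u] misses a vertex of the component, a path there leaves the neighbourhood of [u], and
    [far_nore] applies to the crossing edge. Otherwise a neighbour [z] of [v] is also one of [u];
    then [z' = v] works by [near_nore], unless [u] and [v] are adjacent, which is the star case. *)
Lemma theta_tailed u v s1 s2 r : theta u v s1 s2 r ->
  {in s1 & H, forall a z, ~~ edge a z} -> exists star, tailed star u v.
Proof.
move=> th free.
have [z0 z0H uz0] := theta_H_root th.
case: (boolP [exists z in H, ~~ edge u z]).
  case/existsP=> z1 /andP[z1H nuz1].
  have [s [ps ls sH]] := obs_connected obs z0H z1H.
  have [|a [b [eab aI bI ua ub]]] := path_cross (Q := edge u) ps uz0.
    by rewrite ls.
  have inH c : c \in z0 :: s -> c \in H by rewrite inE => /predU1P[->|/sH].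
  exists false, a; split; [exact: inH | by [] |].
  exists b; split => //; last by left; apply: inH.
  by apply: (far_nore obs th free) ub; apply: inH.
rewrite negb_exists => /forallP full.
have [z zH vz] := theta_H_root (theta_swap th).
have uz : edge u z by have := full z; rewrite zH negbK.
case: (boolP (edge u v)) => uv.
  by exists true, z; split.
exists false, z; split => //; exists v; split; [by rewrite edge_sym| |by right].
exact: (near_nore obs th free zH uz vz uv).
Qed.

Lemma no_theta u v s1 s2 r : theta u v s1 s2 r ->
  {in s1 & H, forall a z, ~~ edge a z} -> False.
Proof.
move=> th free.
have [su tu] := theta_tailed th free.
have [|sv tv] := theta_tailed (theta_swap th).
  by move=> a z; rewrite mem_rev; apply: free.
apply: (@no_frame su sv u v [::] s1 [::] [::] s2 [::] r) => //.
- by split; rewrite ?cats0 //; apply: good_nil.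
- by left.
- by left.
Qed.

End Contradiction.

Lemma first_has (T : Type) (p : pred T) (s : seq T) : has p s ->
  exists s1 x s2, [/\ s = s1 ++ x :: s2, p x & ~~ has p s1].
Proof.
elim: s => //= a s IH; case: (boolP (p a)) => pa.
  by move=> _; exists [::], a, s.
case/IH=> s1 [x [s2 [-> px hs]]]; exists (a :: s1), x, s2.
by split; rewrite //= (negPf pa).
Qed.

(** * The longest cycle of a 2-connected graph *)

Section TwoConnected.
Variable G : sgraph.
Implicit Types (x y z a b u v : G) (c s : seq G).
Hypothesis G_conn : k_connected 2 G.

Lemma path_avoiding a x y : x != a -> y != a ->
  exists s, [/\ path edge x s, last x s = y & a \notin x :: s].
Proof.
move=> xa ya; have card1 : #|[set a]| < 2 by rewrite cards1.
have xS : x \in ~: [set a] by rewrite !inE.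
have yS : y \in ~: [set a] by rewrite !inE.
have /connectP[p pp lp] := G_conn.2 [set a] card1 (exist _ x xS) (exist _ y yS).
exists (map val p).
have xE : x = val (exist (fun z => z \in ~: [set a]) x xS) by [].
split.
- by rewrite {1}xE path_map.
- by rewrite {1}xE last_map -lp.
apply/negP=> aI; have : a \in map val (exist _ x xS :: p) by [].
by case/mapP=> -[b bS] _ /= E; move: bS; rewrite -E !inE eqxx.
Qed.

Lemma other_vertex a b : exists x, (x != a) && (x != b).
Proof.
have : 0 < #|~: [set a; b]|.
  by have := cardsC [set a; b]; have := G_conn.1; rewrite cards2; case: eqP; lia.
by case/card_gt0P=> x; rewrite !inE negb_or; exists x.
Qed.

Lemma has_neighbour_avoiding x a : x != a -> exists2 y, edge x y & y != a.
Proof.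
move=> xa; have [y /andP[yx ya]] := other_vertex x a.
have [[|z s] [/= ps ls]] := path_avoiding xa ya.
  by move: yx; rewrite ls eqxx.
rewrite !inE !negb_or => /and3P[_ az _].
by case/andP: ps => xz _; exists z; rewrite // eq_sym.
Qed.

Lemma has_cycle : exists c, (2 < size c) && ucycleb edge c.
Proof.
have [x _] : exists x : G, x \in G.
  by apply/card_gt0P; apply: leq_trans G_conn.1.
have [y0 /andP[y0x _]] := other_vertex x x.
have [y xy _] : exists2 y, edge x y & y != y0.
  by apply: has_neighbour_avoiding; rewrite eq_sym.
have nxy := edge_neq xy.
have [z xz zy] := has_neighbour_avoiding nxy.
have [||s [ps ls xs]] := @path_avoiding x z y.
- by rewrite eq_sym edge_neq.
- by rewrite eq_sym.
case/shortenP: ps ls xs => s' ps us ss ls xs.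
have xs' : x \notin z :: s'.
  by apply: contra xs; rewrite !inE => /orP[->|/ss->]; rewrite ?orbT.
exists (x :: z :: s'); apply/and3P; split.
- by case: s' ls {ps us ss xs'} => //= E; move: zy; rewrite E eqxx.
- by rewrite /= rcons_path xz ps ls edge_sym.
- by rewrite cons_uniq xs'.
Qed.

Lemma longest_cycle : exists c, [/\ 2 < size c, ucycle edge c &
  forall c', 2 < size c' -> ucycle edge c' -> size c' <= size c].
Proof.
pose P k := (2 < k) && [exists c : k.-tuple G, ucycleb edge c].
have exP : exists k, P k.
  have [c /andP[sc uc]] := has_cycle; exists (size c).
  by rewrite /P sc; apply/existsP; exists (in_tuple c).
have ubP k : P k -> k <= #|G|.
  case/andP=> _ /existsP[c /andP[_ uc]].
  by rewrite -(size_tuple c) -(card_uniqP uc) max_card.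
have [k /andP[k2 /existsP[c cyc]] kmax] := ex_maxnP exP ubP.
exists c; rewrite size_tuple; split => // c' sc' uc'; apply: kmax.
by rewrite /P sc'; apply/existsP; exists (in_tuple c').
Qed.

Section Outside.
Variables (c : seq G) (h : G).
Hypothesis c_size : 2 < size c.
Hypothesis c_cycle : ucycle edge c.
Hypothesis c_max : forall c', 2 < size c' -> ucycle edge c' ->
  size c' <= size c.
Hypothesis hc : h \notin c.
Hypothesis claw_heavy : H_heavy claw G.
Hypothesis wounded_heavy : H_heavy wounded G.

Let out : rel G := [rel x y | [&& x \notin c, y \notin c & edge x y]].
Let C : {set G} := [set x in c].
Let H : {set G} := [set x | connect out h x].

Let C_card : #|C| = size c.
Proof. by rewrite cardsE; apply/card_uniqP; case/andP: c_cycle. Qed.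

Let H_out z : z \in H -> z \notin C.
Proof.
rewrite !inE => /connectP[s ps ->]; case/lastP: s ps => //= s y.
by rewrite rcons_path last_rcons => /andP[_ /and3P[]].
Qed.

Let H_closed z w : z \in H -> edge z w -> w \notin C -> w \in H.
Proof.
move=> zH zw wC; have := H_out zH; rewrite inE => zc.
rewrite inE in zH; rewrite inE; apply: connect_trans zH _.
by apply: connect1; apply/and3P; split=> //; rewrite inE in wC.
Qed.

Let H_conn z z' : z \in H -> z' \in H ->
  exists s, [/\ path edge z s, last z s = z' & {subset s <= H}].
Proof.
rewrite !inE => hz hz'.
have out_sym : connect_sym out.
  by apply: sym_connect_sym => a b; rewrite /out /= edge_sym andbCA.
have /connectP[s ps ->] : connect out z z'.
  by apply: connect_trans hz'; rewrite out_sym.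
exists s; split => //.
  by apply: sub_path ps => a b /and3P[].
elim: s z hz ps => //= y s IH z hz /andP[zy ps] x.
have hy : connect out h y by apply: connect_trans (connect1 zy).
by rewrite inE => /predU1P[->|/(IH y hy ps)//]; rewrite inE.
Qed.

Let C_obstruction : obstruction C H.
Proof.
split => // x y l [s [ps <- pe]] oyx ul.
have us : uniq (x :: s) by rewrite (perm_uniq pe).
(* A closed path on at most two vertices is shorter than [c], which has at least three; the others
   become cycles by [ocycle_cycle]. *)
rewrite C_card -(perm_size pe); case: (ltnP 1 (size s)) => ss; last first.
  by apply: (leq_trans _ c_size); rewrite /= ltnS (leq_trans ss).
have [y0 [t [ut pt et st]]] := ocycle_cycle ss us ps oyx.
apply: (@leq_trans (size (y0 :: t))); first exact: st.
apply: c_max; first exact: (leq_trans ss st).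
by rewrite /ucycle /= rcons_path pt et.
Qed.

Let attached a := [exists z in H, edge a z].

(** A path from [h] to another cycle vertex that avoids [d] leaves the component at an attachment
    different from [d]. *)
Let attached_other d : d \in c -> exists2 a, (a \in c) && (a != d) & attached a.
Proof.
move=> dc.
have [e ec ed] : exists2 e, e \in c & e != d.
  have [s [us pe]] := ucycle_rot_to c_cycle dc.
  have : 1 < size (d :: s) by rewrite (perm_size pe) ltnW.
  case: s us pe => // e s us pe _; exists e.
    by rewrite -(perm_mem pe) !inE eqxx orbT.
  by case/andP: us => _ /=; rewrite inE negb_or eq_sym => /andP[/andP[]].
have hd : h != d by apply: contraNneq hc => ->.
have [s [ps ls ds]] := path_avoiding hd ed.
have hH : h \in H by rewrite inE.
have [|a [b [ab aI bI aH bH]]] := path_cross (Q := mem H) ps hH.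
  by rewrite ls /=; apply/negP=> /H_out; rewrite inE ec.
have bc : b \in c.
  by apply: contraR bH => bc; apply: H_closed aH ab _; rewrite inE.
exists b; first by rewrite bc; apply: contraNneq ds => <-.
by apply/existsP; exists a; rewrite edge_sym ab andbT.
Qed.

Lemma outside_False : False.
Proof.
have [d dc] : exists d, d \in c.
  by case: c c_size => // d s _; exists d; rewrite mem_head.
have [u /andP[uc _] uA] := attached_other dc.
have [s [us pe]] := ucycle_rot_to c_cycle uc.
have [v0 /andP[v0c v0u] v0A] := attached_other uc.
have hasA : has attached s.
  apply/hasP; exists v0 => //.
  by move: v0c; rewrite -(perm_mem pe) inE (negPf v0u).
(* Taking the first attachment after [u] leaves none strictly between the two roots on [s1]; the
   side [s2] may contain further ones. *)
have [s1 [v [s2 [E vA s1A]]]] := first_has hasA; subst s.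
have [zu /andP[zuH uzu]] := existsP uA.
have [zv /andP[zvH vzv]] := existsP vA.
have [t [pt lt tH]] := H_conn zuH zvH.
case/shortenP: pt lt => t' pt' ut' st' lt.
case/andP: us => + uniqs.
rewrite /= rcons_cat cat_path /= => /and3P[p1 e1 p2].
apply: (@no_theta G C H C_obstruction u v s1 (rev s2) (zu :: t')).
  split => //.
  - by rewrite rcons_path p1.
  - exact: (rcons_path_rev (@edge_sym G) p2).
  - by rewrite /= uzu rcons_path pt' lt edge_sym.
  - by apply: (@perm_uniq_imp _ (u :: v :: s1 ++ rev s2) _ _ uniqs);
      perm_by_count.
  - move=> x; rewrite [RHS]in_set -(perm_mem pe) !inE !mem_cat !inE mem_rev.
    by congr (_ || _); apply: orbCA.
  - by move=> x; rewrite inE => /predU1P[->|/st'/tH].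
move=> a z aI zH; apply/negP=> az.
by case/hasP: s1A; exists a => //; apply/existsP; exists z; rewrite zH.
Qed.

End Outside.
End TwoConnected.

Theorem theorem3 (G : sgraph)
  (G_2connected : k_connected 2 G)
  (G_heavy : family_heavy (fun H => H = claw \/ H = wounded) G) :
  hamiltonian G.
Proof.
have [c [sc cyc cmax]] := longest_cycle G_2connected.
exists c; split => // h; apply/negPn/negP=> hc.
apply: (outside_False G_2connected sc cyc cmax hc); apply: G_heavy; auto.
Qed.
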